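(* Let $D\ge1$ and let $f:\mathbb{R}^D\to\mathbb{R}$ be continuously differentiable with effective dimensionality $d_e\ge 1$, attaining its global minimum $f^*=\min_{\boldsymbol{x}\in\mathbb{R}^D}f(\boldsymbol{x})$, and suppose there exists $L>0$ such that $\|\nabla f(\boldsymbol{x})\|\le L$ for all $\boldsymbol{x}\in\mathbb{R}^D$. Let $\rho$ be a probability density with support the whole of $\mathbb{R}^D$, let $$\boldsymbol{C}=\int\nabla f(\boldsymbol{x})\nabla f(\boldsymbol{x})^T\rho(\boldsymbol{x})\,d\boldsymbol{x},\qquad \hat{\boldsymbol{C}}=\frac1M\sum_{j=1}^M\nabla f(\boldsymbol{x}_S^j)\nabla f(\boldsymbol{x}_S^j)^T,$$ where $M\geq 1$ is an integer and $\boldsymbol{x}_S^1,\dots,\boldsymbol{x}_S^M$ are drawn independently at random according to $\rho$. Let $\lambda_1\ge\dots\ge\lambda_{d_e}\ge0$ and $\hat\lambda_1\ge\dots\ge\hat\lambda_{d_e}\ge0$ be the $d_e$ largest eigenvalues of $\boldsymbol{C}$ and $\hat{\boldsymbol{C}}$, respectively. Then for all $\alpha\in(0,1]$, $\tau\in[0,1)$ and $k\in\{1,\dots,d_e\}$, $$\text{if}\quad M\ge\frac{4\lambda_1L^2}{\lambda_k^2(1-\tau)^2}\log\left(\frac{k}{\alpha}\right),\quad\text{then}\quad \mathbb{P}\big[\hat\lambda_k>\tau\lambda_k\big]\ge1-\alpha.$$ In particular, for all $\alpha\in(0,1]$, $$\text{if}\quad M\ge\frac{4\lambda_1L^2}{\lambda_{d_e}^2}\log\left(\frac{d_e}{\alpha}\right),\quad\text{then}\quad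 \mathbb{P}\big[\text{the reduced problem is successful}\big]\ge1-\alpha,$$ where the reduced problem is $\min_{\boldsymbol{y}\in\mathbb{R}^d}f(\hat{\boldsymbol{U}}\boldsymbol{y}+\boldsymbol{p})$, with $d=\operatorname{rank}(\hat{\boldsymbol{C}})$, $\hat{\boldsymbol{U}}\in\mathbb{R}^{D\times d}$ any full column rank matrix whose columns span $\operatorname{range}(\hat{\boldsymbol{C}})$, and $\boldsymbol{p}\in\mathbb{R}^D$.
   Context: A function $f:\mathbb{R}^D\to\mathbb{R}$ has effective dimensionality $d_e\le D$ if (i) there exists a linear subspace $\mathcal{T}\subset\mathbb{R}^D$ of dimension $d_e$ such that $f(\boldsymbol{x}_\top+\boldsymbol{x}_\perp)=f(\boldsymbol{x}_\top)$ for all $\boldsymbol{x}_\top\in\mathcal{T}$ and all $\boldsymbol{x}_\perp\in\mathcal{T}^\perp$, and (ii) $d_e$ is the smallest integer with this property. For $\boldsymbol{A}\in\mathbb{R}^{D\times d}$ and $\boldsymbol{p}\in\mathbb{R}^D$, the reduced problem $\min_{\boldsymbol{y}\in\mathbb{R}^d}f(\boldsymbol{A}\boldsymbol{y}+\boldsymbol{p})$ is called successful if there exists $\boldsymbol{y}\in\mathbb{R}^d$ such that $f(\boldsymbol{A}\boldsymbol{y}+\boldsymbol{p})=f^*$. ''$\rho$ has support the whole of $\mathbb{R}^D$'' means that the probability measure $\rho(\boldsymbol{x})\,d\boldsymbol{x}$ gives positive mass to every nonempty open set. Under these hypotheses $\operatorname{rank}(\boldsymbol{C})=d_e$ (so $\lambda_{d_e}>0$),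 and $\boldsymbol{C}$ and $\hat{\boldsymbol{C}}$ have at most $d_e$ nonzero eigenvalues. $\|\cdot\|$ is the Euclidean norm and $\log$ the natural logarithm. *)

(* Defs.v *)
From HB Require Import structures.
From mathcomp Require Import all_boot all_order all_algebra.
From mathcomp Require Import all_classical all_reals all_analysis.
From mathcomp Require Import complex.

Set Implicit Arguments.
Unset Strict Implicit.
Unset Printing Implicit Defensive.

Import Order.TTheory GRing.Theory Num.Theory.
Import numFieldNormedType.Exports.

Local Open Scope classical_set_scope.
Local Open Scope ring_scope.

Section euclidean_space.
Variable R : realType.

(* R^n as column vectors with the Borel sigma-algebra; the topology of
   'cV[R]_n is that of the sup norm, i.e. the usual one. *)
Definition borelRn (n : nat) := g_sigma_algebraType (@open 'cV[R]_n).

Section cons.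
Variable n : nat.

Definition cv_cons (p : borelRn n * measurableTypeR R) : borelRn n.+1 :=
  col_mx (p.2%:M : 'cV[R]_1) (p.1 : 'cV[R]_n).

Lemma cv_cons0 p : cv_cons p ord0 ord0 = p.2.
Proof.
rewrite /cv_cons (_ : ord0 = lshift n (ord0 : 'I_1)); last exact: val_inj.
by rewrite (@col_mxEu _ 1 n 1) mxE eqxx mulr1n.
Qed.

Lemma cv_consS p (i : 'I_n) : cv_cons p (lift ord0 i) ord0 = p.1 i ord0.
Proof.
rewrite /cv_cons (_ : lift ord0 i = rshift 1 i); last exact: val_inj.
by rewrite (@col_mxEd _ 1 n 1).
Qed.

End cons.

Lemma open_mx_box (n : nat) (O : set 'cV[R]_n) (x : 'cV[R]_n) :
  open O -> O x -> exists q : 'cV[rat]_n * 'cV[rat]_n,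
    (forall i, ratr (q.1 i 0) < x i 0 < ratr (q.2 i 0)) /\
    [set y : 'cV[R]_n | forall i, ratr (q.1 i 0) < y i 0 < ratr (q.2 i 0)]
      `<=` O.
Proof.
move=> oO Ox; have /nbhs_ballP[e /= e0 eO] := open_nbhs_nbhs (conj oO Ox).
have H i : exists pq : rat * rat,
    [/\ x i 0 - e < ratr pq.1, ratr pq.1 < x i 0, x i 0 < ratr pq.2 &
    ratr pq.2 < x i 0 + e].
  have /rat_in_itvoo[p /itvP pP] : x i 0 - e < x i 0.
    by rewrite ltrBlDr ltrDl.
  have /rat_in_itvoo[q /itvP qP] : x i 0 < x i 0 + e.
    by rewrite ltrDl.
  by exists (p, q); split => /=; rewrite ?pP ?qP.
have [g gP] := choice H.
exists (\col_i (g i).1, \col_i (g i).2); split => [i|y /= yP].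
  by have [_ h1 h2 _] := gP i; rewrite !mxE h1 h2.
apply: eO; split => // i j; rewrite ord1.
have [h1 _ _ h4] := gP i; have := yP i; rewrite !mxE => /andP[h2 h3].
rewrite -ball_normE /= ltr_distlC.
by rewrite (lt_trans h1 h2) (lt_trans h3 h4).
Qed.

Lemma measurable_open_box n (a b : 'cV[R]_n) :
  measurable [set y : borelRn n | forall i, a i 0 < y i 0 < b i 0].
Proof.
rewrite [X in measurable X](_ : _ = \bigcap_(i in [set: 'I_n])
    [set y : borelRn n | a i 0 < y i 0 < b i 0]); last first.
  by apply/seteqP; split => [y h i _|y h i]; apply: h.
apply: fin_bigcap_measurable => // i _.
apply: sub_sigma_algebra => /=.
have -> : [set y : 'cV[R]_n | a i 0 < y i 0 < b i 0] =
    (fun y : 'cV[R]_n => y i 0) @^-1` `]a i 0, b i 0[%classic.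
  by apply/seteqP; split => y /=; rewrite in_itv.
apply: open_comp; last exact: interval_open.
by move=> y _; exact: coord_continuous.
Qed.

Lemma measurable_cv_cons n : measurable_fun setT (@cv_cons n).
Proof.
refine (@measurability _ _ _ (borelRn n.+1) setT (@cv_cons n)
  (@open 'cV[R]_n.+1) erefl _).
move=> _ [U oU <-]; rewrite setTI.
pose box (q : 'cV[rat]_n.+1 * 'cV[rat]_n.+1) :=
  [set y : 'cV[R]_n.+1 | forall i, ratr (q.1 i 0) < y i 0 < ratr (q.2 i 0)].
have -> : U = \bigcup_(q in [set q | box q `<=` U]) box q.
  apply/seteqP; split => [x Ux|x [q /= qU]]; last exact: qU.
  by have [q [qx qU]] := open_mx_box oU Ux; exists q.
rewrite preimage_bigcup bigcup_mkcond.
apply: countable_bigcupT_measurable => [|q]; first exact: countableP.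
case: ifP => _; last exact: measurable0.
have -> : @cv_cons n @^-1` box q =
    [set y : borelRn n | forall i : 'I_n,
       ratr (q.1 (lift ord0 i) 0) < y i 0 < ratr (q.2 (lift ord0 i) 0)] `*`
    [set t : measurableTypeR R | ratr (q.1 ord0 0) < t < ratr (q.2 ord0 0)].
  apply/seteqP; split => [[y t]|[y t]] /= => [h|[hy ht] i].
    split => [i|].
      by have := h (lift ord0 i); rewrite cv_consS.
    by have := h ord0; rewrite cv_cons0.
  case: (unliftP ord0 i) => [j|] -> /=.
    by rewrite cv_consS; apply: hy.
  by rewrite cv_cons0.
apply: measurableX.
  have := measurable_open_box (\col_i ratr (q.1 (lift ord0 i) 0))
    (\col_i ratr (q.2 (lift ord0 i) 0)).
  by congr measurable; apply/seteqP; split => y h i; have := h i; rewrite !mxE.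
have -> : [set t : measurableTypeR R | ratr (q.1 ord0 0) < t < ratr (q.2 ord0 0)]
    = `]ratr (q.1 ord0 0), ratr (q.2 ord0 0)[%classic.
  by apply/seteqP; split => y /=; rewrite in_itv.
exact: measurable_itv.
Qed.

Section lebesgue_cons.
Variables (n : nat) (mu : {measure set (borelRn n) -> \bar R}).

Definition lebesgue_cons : set (borelRn n.+1) -> \bar R :=
  pushforward (mu \x lebesgue_measure)%E (@cv_cons n).

Let nu : {measure set (borelRn n.+1) -> \bar R} :=
  measure_function_pushforward__canonical__measure_function_Measure
    (mu \x lebesgue_measure)%E (@measurable_cv_cons n).

Let lebesgue_cons0 : lebesgue_cons set0 = 0%E.
Proof. exact: (measure0 nu). Qed.

Let lebesgue_cons_ge0 A : (0 <= lebesgue_cons A)%E.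
Proof. exact: (measure_ge0 nu). Qed.

Let lebesgue_cons_sigma_additive : semi_sigma_additive lebesgue_cons.
Proof. exact: (@measure_semi_sigma_additive _ _ _ nu). Qed.

HB.instance Definition _ := isMeasure.Build _ _ _ lebesgue_cons
  lebesgue_cons0 lebesgue_cons_ge0 lebesgue_cons_sigma_additive.

End lebesgue_cons.

(* Iterated product of one-dimensional Lebesgue measures, characterized by
   lebesgueRn_box; on R^0 it is the unit mass. *)
Fixpoint lebesgueRn (n : nat) : {measure set (borelRn n) -> \bar R} :=
  match n with
  | 0 => @dirac _ (borelRn 0) (0 : 'cV[R]_0) R
  | m.+1 => lebesgue_cons (lebesgueRn m)
  end.

Lemma lebesgueRn_box n (a b : 'cV[R]_n) : (forall i, a i 0 <= b i 0) ->
  lebesgueRn n [set x | forall i, a i 0 < x i 0 < b i 0] =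
  (\prod_i (b i 0 - a i 0))%:E.
Proof.
elim: n a b => [|n IH] a b ab /=.
  rewrite big_ord0 diracE mem_set//; by case.
pose tl (x : 'cV[R]_n.+1) : 'cV[R]_n := \col_i x (lift ord0 i) 0.
rewrite /lebesgue_cons /pushforward big_ord_recl.
transitivity ((lebesgueRn n \x lebesgue_measure)%E
  ([set y : borelRn n | forall i, tl a i 0 < y i 0 < tl b i 0] `*`
   [set` `]a ord0 0, b ord0 0[ ])).
  congr (_ _); apply/seteqP; split => [[y t]|[y t]] /=.
    move=> h; split => [i|]; rewrite ?in_itv ?mxE.
      by have := h (lift ord0 i); rewrite cv_consS.
    by have := h ord0; rewrite cv_cons0.
  rewrite in_itv => -[hy ht] i; case: (unliftP ord0 i) => [j|] -> /=.
    by have := hy j; rewrite cv_consS !mxE.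
  by rewrite cv_cons0.
rewrite product_measure1E//; last exact: measurable_open_box.
have tab i : tl a i 0 <= tl b i 0 by rewrite !mxE.
rewrite IH // muleC.
rewrite [X in (X * _)%E](lebesgue_measure_itv `]a ord0 0, b ord0 0[) /=
  lte_fin -EFinB.
have -> : (if a ord0 0 < b ord0 0 then (b ord0 0 - a ord0 0)%:E else 0%E) =
    (b ord0 0 - a ord0 0)%:E.
  case: ltP => // h; apply/esym/congr1/eqP; rewrite subr_eq0 eq_le h.
  exact: ab.
rewrite -EFinM; congr (_ * _)%:E.
by apply: eq_bigr => i _; rewrite !mxE.
Qed.

End euclidean_space.

Section spectrum.
Variable R : realType.

(* Eigenvalues are listed in nonincreasing order, with multiplicity. *)
Definition is_spectrum n (A : 'M[R]_n) (s : seq R) :=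
  sorted >=%R s /\ char_poly A = \prod_(x <- s) ('X - x%:P).

(* The empty sequence when char_poly A does not split over R; by spectrumP
   this does not happen for symmetric A. *)
Definition spectrum n (A : 'M[R]_n) : seq R :=
  xget [::] [set s | is_spectrum A s].

(* The k-th largest eigenvalue, indexed from k = 1. *)
Definition eigval n (A : 'M[R]_n) (k : nat) : R := nth 0 (spectrum A) k.-1.

Lemma spectrumP n (A : 'M[R]_n) : A^T = A -> is_spectrum A (spectrum A).
Proof.
move=> symA; rewrite /spectrum; case: xgetP => [s -> //|no].
pose inC := real_complex R.
pose B : 'M[R[i]]_n := map_mx inC A.
have Bherm : B \is hermsymmx.
  apply: realsym_hermsym.
    by apply/is_hermitianmxP; rewrite expr0 scale1r map_mx_id// map_trmx symA.
  apply/mxOverP => i j; by rewrite mxE complex_real.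
have Breal := hermitian_spectral_diag_real Bherm.
have /orthomx_spectralP BE := hermitian_normalmx Bherm.
have cB : char_poly B = \prod_i ('X - (spectral_diag B 0 i)%:P).
  have VP : map_mx polyC (invmx (spectralmx B)) *m
      map_mx polyC (spectralmx B) = 1%:M.
    by rewrite -map_mxM mulVmx ?spectral_unit// map_mx1.
  rewrite -[LHS]/(\det (_ - map_mx polyC B)) {1}BE.
  transitivity (char_poly (diag_mx (spectral_diag B))); last first.
    rewrite char_poly_trig ?diag_mx_is_trig//.
    by apply: eq_bigr => i _; rewrite mxE eqxx mulr1n.
  rewrite /char_poly /char_poly_mx !map_mxM.
  set V := map_mx _ (invmx _) in VP *; set P := map_mx _ (spectralmx _) in VP *.
  set D := map_mx _ (diag_mx _).
  have -> : 'X%:M - V *m D *m P = V *m ('X%:M - D) *m P.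
    by rewrite mulmxBr mulmxBl scalar_mxC -[_ *m V *m P]mulmxA VP mulmx1.
  by rewrite !det_mulmx mulrAC -det_mulmx VP det1 mul1r.
pose d i : R := complex.Re (spectral_diag B 0 i).
exfalso; apply: (no (sort >=%R [seq d i | i <- enum 'I_n])); split.
  apply: sort_sorted => x y; exact: le_total.
have inj : injective (map_poly inC) by apply: map_poly_inj.
apply: inj; rewrite map_char_poly cB rmorph_prod /=.
rewrite (perm_big [seq d i | i <- enum 'I_n]) /=; last by rewrite perm_sort.
rewrite big_map big_enum; apply: eq_bigr => i _.
rewrite rmorphB /= map_polyX map_polyC /=; congr (_ - _%:P).
exact: (esym (RRe_real (mxOverP Breal 0 i))).
Qed.

End spectrum.

Section active_subspace.
Variable R : realType.

Definition dot n (u v : 'cV[R]_n) : R := \sum_i u i 0 * v i 0.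

(* The library norm `|x| on matrices is the sup norm. *)
Definition enorm n (x : 'cV[R]_n) : R := Num.sqrt (dot x x).

Definition gradient n (f : 'cV[R]_n -> R) (x : 'cV[R]_n) : 'cV[R]_n :=
  \col_i 'D_(delta_mx i 0) f x.

Definition continuously_differentiable n (f : 'cV[R]_n -> R) :=
  (forall x, differentiable f x) /\ continuous (gradient f).

Definition is_global_min n (f : 'cV[R]_n -> R) (fstar : R) :=
  (exists x, f x = fstar) /\ (forall x, fstar <= f x).

Definition determined_on n (f : 'cV[R]_n -> R) (T : {vspace 'cV[R]_n}) :=
  forall x y, x \in T -> (forall t, t \in T -> dot t y = 0) ->
    f (x + y) = f x.

Definition effective_dim n (f : 'cV[R]_n -> R) (de : nat) :=
  (exists2 T : {vspace 'cV[R]_n}, \dim T = de & determined_on f T) /\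
  (forall T : {vspace 'cV[R]_n}, determined_on f T -> (de <= \dim T)%N).

Definition successful n (f : 'cV[R]_n -> R) (fstar : R) d
    (A : 'M[R]_(n, d)) (p : 'cV[R]_n) :=
  exists y : 'cV[R]_d, f (A *m y + p) = fstar.

Definition prob_density n (rho : borelRn R n -> R) :=
  [/\ measurable_fun setT rho, (forall x, 0 <= rho x) &
      (\int[lebesgueRn R n]_x (rho x)%:E = 1)%E].

Definition full_support n (rho : borelRn R n -> R) :=
  forall U : set 'cV[R]_n, open U -> U !=set0 ->
    (0 < \int[lebesgueRn R n]_(x in (U : set (borelRn R n))) (rho x)%:E)%E.

Definition grad_outer n (f : 'cV[R]_n -> R) (x : 'cV[R]_n) : 'M[R]_n :=
  gradient f x *m (gradient f x)^T.

Definition grad_covariance n (f : 'cV[R]_n -> R) (rho : borelRn R n -> R) :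
    'M[R]_n :=
  \matrix_(i, j) \int[lebesgueRn R n]_x (grad_outer f x i j * rho x).

Definition sample_covariance n (f : 'cV[R]_n -> R) M (x : 'I_M -> 'cV[R]_n) :
    'M[R]_n :=
  M%:R^-1 *: \sum_(j < M) grad_outer f (x j).

(* Taking B j = setT outside a subset of indices gives the product rule for
   every subfamily. *)
Definition mutually_independent d d' (Omega : measurableType d)
    (T : measurableType d') (P : probability Omega R) M
    (X : 'I_M -> {RV P >-> T}) :=
  forall B : 'I_M -> set T, (forall j, measurable (B j)) ->
    (P (\bigcap_(j in [set: 'I_M]) X j @^-1` B j) =
     \prod_(j < M) P (X j @^-1` B j))%E.

Definition has_density d (Omega : measurableType d) (P : probability Omega R)
    n (X : {RV P >-> borelRn R n}) (rho : borelRn R n -> R) :=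
  forall B, measurable B ->
    distribution P X B = (\int[lebesgueRn R n]_(x in B) (rho x)%:E)%E.

(* U has full column rank and its columns span the range of A; row spaces of
   transposes are column spaces. *)
Definition is_range_basis n d (A : 'M[R]_n) (U : 'M[R]_(n, d)) :=
  \rank U = d /\ (U^T == A^T)%MS.

End active_subspace.

(* Main.v *)
(** Let [W] collect the [k] leading eigenvectors of [C] and put
    [v_j = W^T grad f(x_j)]. It suffices to bound from below the least eigenvalue
    of [sum_j v_j v_j^T], and for this a matrix Chernoff argument is used in which
    the trace exponential [tr exp(- theta sum_j v_j v_j^T)] is replaced by
    [tr A_M^N], with [A_j = 1 - (theta / N) sum_(i < j) v_i v_i^T] and [N] large.
    The Golden-Thompson inequality then reduces to scalar inequalities between
    the moments [v^T A^i v]: one rank-one step satisfies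
    [tr A_(j+1)^N <= tr A_j^N - theta (1 - theta L^2 / (1 - kappa)^2) v_j^T A_j^N v_j]
    with [kappa = theta M L^2 / N]. As [A_j^N] is a polynomial in the first [j]
    gradients, independence turns this into a geometric decay of [E tr A_j^N].
    Markov's inequality, the limit [N -> oo] and [theta = (1 - tau) / (2 L^2)] give
    the first claim.

    By full support, [grad f] is pointwise orthogonal to every [y] with
    [y^T C y = 0], so that [rank C < de] would contradict the minimality of [de];
    hence [lambda_de > 0]. When [hat-lambda_de > 0] the range of [hat-C] is the
    whole effective subspace, on which a minimizer can be reached from any [p]. *)

Require Import Defs.
From HB Require Import structures.
From mathcomp Require Import all_boot all_order all_algebra.
From mathcomp Require Import all_classical all_reals all_analysis.
From mathcomp Require Import measurable_realfun.
From mathcomp Require Import ring lra.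

Set Implicit Arguments.
Unset Strict Implicit.
Unset Printing Implicit Defensive.

Import Order.TTheory GRing.Theory Num.Theory.
Import numFieldNormedType.Exports.

Local Open Scope classical_set_scope.
Local Open Scope ring_scope.

(** * Real spectral theorem *)

Section dot.
Variable R : realType.

Lemma dotE n (u v : 'cV[R]_n) : dot u v = (u^T *m v) 0 0.
Proof. by rewrite mxE; apply: eq_bigr => i _; rewrite mxE. Qed.

Lemma dotC n (u v : 'cV[R]_n) : dot u v = dot v u.
Proof. by apply: eq_bigr => i _; rewrite mulrC. Qed.

Lemma dotDr n (u v w : 'cV[R]_n) : dot u (v + w) = dot u v + dot u w.
Proof. by rewrite !dotE mulmxDr mxE. Qed.

Lemma dotZr n (u v : 'cV[R]_n) a : dot u (a *: v) = a * dot u v.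
Proof. by rewrite !dotE -scalemxAr mxE. Qed.

Lemma dotNr n (u v : 'cV[R]_n) : dot u (- v) = - dot u v.
Proof. by rewrite -scaleN1r dotZr mulN1r. Qed.

Lemma dotBr n (u v w : 'cV[R]_n) : dot u (v - w) = dot u v - dot u w.
Proof. by rewrite dotDr dotNr. Qed.

Lemma dotZl n (u v : 'cV[R]_n) a : dot (a *: v) u = a * dot v u.
Proof. by rewrite dotC dotZr dotC. Qed.

Lemma dotBl n (u v w : 'cV[R]_n) : dot (v - w) u = dot v u - dot w u.
Proof. by rewrite dotC dotBr !(dotC u). Qed.

Lemma dot0r n (u : 'cV[R]_n) : dot u 0 = 0.
Proof. by rewrite dotE mulmx0 mxE. Qed.

Lemma dot_sumr n (I : Type) (r : seq I) (Q : pred I) (F : I -> 'cV[R]_n) u :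
  dot u (\sum_(i <- r | Q i) F i) = \sum_(i <- r | Q i) dot u (F i).
Proof. by elim/big_ind2: _ => [|x a y b <- <-|//]; rewrite ?dot0r ?dotDr. Qed.

Lemma dot_mulmx n m (A : 'M[R]_(n, m)) u v :
  dot u (A *m v) = dot (A^T *m u) v.
Proof. by rewrite !dotE trmx_mul trmxK mulmxA. Qed.

Lemma dot_ge0 n (u : 'cV[R]_n) : 0 <= dot u u.
Proof. by apply: sumr_ge0 => i _; rewrite -expr2 sqr_ge0. Qed.

Lemma dot_eq0 n (u : 'cV[R]_n) : (dot u u == 0) = (u == 0).
Proof.
apply/eqP/eqP => [/eqP|->]; last exact: dot0r.
rewrite psumr_eq0 => [/allP h|i _]; last by rewrite -expr2 sqr_ge0.
apply/colP => i; have := h i (mem_index_enum i).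
by rewrite -expr2 sqrf_eq0 => /eqP ->; rewrite mxE.
Qed.

Lemma dot_gt0 n (u : 'cV[R]_n) : u != 0 -> 0 < dot u u.
Proof. by move=> u0; rewrite lt_neqAle dot_ge0 eq_sym dot_eq0 u0. Qed.

Lemma dot_delta n (u : 'cV[R]_n) i : dot (delta_mx i 0) u = u i 0.
Proof.
rewrite /dot (bigD1 i)//= mxE !eqxx mul1r big1 ?addr0// => j ji.
by rewrite mxE (negPf ji) mul0r.
Qed.

Lemma mulmx_outer n (v w x : 'cV[R]_n) : v *m w^T *m x = dot w x *: v.
Proof.
rewrite -mulmxA (mx11_scalar (w^T *m x)) mul_mx_scalar.
by rewrite dotE.
Qed.

Lemma dot_CauchySchwarz n (u v : 'cV[R]_n) :
  dot u v ^+ 2 <= dot u u * dot v v.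
Proof.
have [/eqP|v0] := boolP (v == 0).
  by move=> ->; rewrite !dot0r mulr0 expr0n.
have := dot_ge0 (dot v v *: u - dot u v *: v).
rewrite !dotBr !dotBl !dotZl !dotZr (dotC v u).
have := dot_gt0 v0; set a := dot u u; set b := dot v v; set c := dot u v.
move=> b0 h.
rewrite -(ler_pM2l b0) -subr_ge0; apply: le_trans h _.
by rewrite le_eqVlt; apply/orP; left; apply/eqP; ring.
Qed.

End dot.

Section spectral.
Variable R : realType.

(** Deflation tool for [spectral_real]. A symmetric involution is produced, so that conjugation by
    it preserves symmetry and is undone by itself; when [v] is already the basis row, the identity
    serves. *)
Lemma orthomx_map_delta n (v : 'rV[R]_n.+1) : v *m v^T = 1%:M ->
  exists Q : 'M[R]_n.+1, [/\ Q^T = Q, Q *m Q = 1%:M & delta_mx 0 0 *m Q = v].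
Proof.
move=> vv; pose e : 'rV[R]_n.+1 := delta_mx 0 0; pose u := v - e.
have [/eqP u0|u0] := boolP (u == 0).
  exists 1%:M; rewrite trmx1 !mulmx1; split => //.
  by apply/esym/eqP; rewrite -subr_eq0; apply/eqP.
have ee : e *m e^T = 1%:M.
  by rewrite trmx_delta mul_delta_mx; apply/matrixP => i j; rewrite !mxE !ord1.
have ev : e *m v^T = (v 0 0)%:M.
  rewrite -rowE; apply/matrixP => i j.
  by rewrite !mxE !ord1 eqxx mulr1n.
have ve : v *m e^T = (v 0 0)%:M.
  by rewrite -[LHS]trmxK trmx_mul trmxK ev tr_scalar_mx.
pose c := 1 - v 0 0.
have uu : u *m u^T = (c *+ 2)%:M.
  rewrite /u linearB /= mulmxBl !mulmxBr vv ee ev ve.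
  apply/matrixP => i j; rewrite !mxE !ord1 eqxx /c; ring.
have eu : e *m u^T = (- c)%:M.
  rewrite /u linearB /= mulmxBr ev ee.
  apply/matrixP => i j; rewrite !mxE !ord1 eqxx /c; ring.
have c0 : c != 0.
  apply: contra_neq u0 => c0; move: uu; rewrite c0 mul0rn => uu.
  apply/eqP; rewrite -(inj_eq trmx_inj) trmx0 -dot_eq0 dotE trmxK uu.
  by rewrite mxE mul0rn.
(* the Householder reflection along [u = v - e]; here [c = |u|^2 / 2] *)
exists (1%:M - c^-1 *: (u^T *m u)); split.
- by rewrite linearB /= trmx1 linearZ /= trmx_mul trmxK.
- pose K := u^T *m u; rewrite -/K.
  have KK : K *m K = (c *+ 2) *: K.
    by rewrite /K mulmxA -(mulmxA u^T) uu mul_mx_scalar scalemxAl.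
  have -> : (1%:M - c^-1 *: K) *m (1%:M - c^-1 *: K) =
      1%:M - (c^-1 *: K *+ 2) + (c^-1 * c^-1) *: (K *m K).
    rewrite !(mulmxBl, mulmxBr) !(mulmx1, mul1mx) -scalemxAl -scalemxAr scalerA.
    by rewrite opprB mulr2n opprD !addrA addrAC.
  rewrite KK scalerA -scaler_nat scalerA -addrA -scaleNr -scalerDl.
  rewrite [X in X *: _](_ : _ = 0) ?scale0r ?addr0//.
  by field.
- rewrite mulmxBr mulmx1 -scalemxAr mulmxA eu mul_scalar_mx scalerA.
  by rewrite mulrN mulVf// scaleN1r opprK /u addrC subrK.
Qed.

(** Induction by deflation: a unit eigenvector for the first root [a] is moved to the first basis
    row, symmetry then makes the matrix block-diagonal, and the lower block has the remaining roots.
    Following the list [s] fixes the order on the diagonal. *)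
Lemma spectral_real n (A : 'M[R]_n) (s : seq R) :
  A^T = A -> char_poly A = \prod_(x <- s) ('X - x%:P) ->
  exists P : 'M[R]_n, P *m P^T = 1%:M /\
    A = P^T *m diag_mx (\row_i s`_i) *m P.
Proof.
elim: n A s => [|n IH] A s symA cA.
  exists 1%:M; rewrite trmx1 mulmx1; split => //.
  by apply/matrixP => -[].
case: s cA => [|a s] cA.
  have := size_char_poly A; by rewrite cA big_nil size_poly1.
have /eigenvalueP[v vA v0] : eigenvalue A a.
  by rewrite eigenvalue_root_char cA big_cons rootM root_XsubC eqxx.
have {v0} v0 : v^T != 0 by rewrite -(inj_eq trmx_inj) trmxK trmx0.
have vv := dot_gt0 v0.
pose w := (Num.sqrt (dot v^T v^T))^-1 *: v.
have ww : w *m w^T = 1%:M.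
  apply/matrixP => i j; rewrite !ord1 linearZ /= -scalemxAr -scalemxAl !mxE.
  rewrite -[X in _ * (_ * X)]/(\sum_ _ _).
  have -> : \sum_k v 0 k * v^T k 0 = dot v^T v^T.
    by apply: eq_bigr => k _; rewrite !mxE.
  rewrite mulrA -expr2 exprVn sqr_sqrtr ?mulVf ?eqxx//; last exact: ltW.
  by rewrite gt_eqF.
have wA : w *m A = a *: w by rewrite /w -scalemxAl vA scalerA mulrC -scalerA.
have [Q [symQ QQ eQ]] := orthomx_map_delta ww.
pose B : 'M[R]_(1 + n) := Q *m A *m Q.
have symB : B^T = B by rewrite /B !trmx_mul symQ symA mulmxA.
have eB : delta_mx 0 0 *m B = a *: delta_mx 0 0 :> 'rV[R]_(1 + n).
  rewrite /B !mulmxA eQ wA -scalemxAl -eQ -mulmxA QQ mulmx1//.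
have AE : A = Q *m B *m Q.
  by rewrite /B !mulmxA QQ mul1mx -mulmxA QQ mulmx1.
clearbody B.
have B0 j : B 0 j = a *+ (j == 0).
  have /rowP/(_ j) := eB; rewrite -rowE !mxE eqxx /= => ->.
  by rewrite mulr_natr.
have l0 : lshift n (0 : 'I_1) = 0 by apply: val_inj.
pose B' := drsubmx B.
have BE : B = block_mx a%:M 0 0 B'.
  rewrite -[LHS]submxK; congr block_mx.
  - by apply/matrixP => i j; rewrite !mxE !ord1 l0 B0 !eqxx.
  - by apply/matrixP => i j; rewrite !mxE !ord1 l0 B0.
  - by apply/matrixP => i j; rewrite !mxE !ord1 -symB mxE l0 B0.
have symB' : B'^T = B' by rewrite /B' trmx_drsub symB.
have cB : char_poly B = char_poly A.
  have QP : map_mx polyC Q *m map_mx polyC Q = 1%:M.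
    by rewrite -map_mxM QQ map_mx1.
  rewrite AE /char_poly /char_poly_mx !map_mxM.
  set q := map_mx _ Q in QP *; set b := map_mx _ _.
  have -> : 'X%:M - q *m b *m q = q *m ('X%:M - b) *m q.
    by rewrite mulmxBr mulmxBl scalar_mxC -[_ *m q *m q]mulmxA QP mulmx1.
  by rewrite !det_mulmx mulrAC -det_mulmx QP det1 mul1r.
have /(IH _ _ symB')[P' [PP' BE']] : char_poly B' = \prod_(x <- s) ('X - x%:P).
  (* The factor of the first block is cancelled, which leaves exactly the roots in the tail of the
     list. *)
  apply: (@mulfI _ ('X - a%:P)); first by rewrite polyXsubC_eq0.
  rewrite [RHS](_ : _ = char_poly B); last by rewrite cB cA big_cons.
  rewrite BE /char_poly (char_block_diag_mx a%:M B').
  rewrite det_ublock; congr (_ * _).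
  by rewrite det_mx11 !mxE eqxx !mulr1n.
pose K : 'M[R]_(1 + n) := block_mx 1%:M 0 0 P'.
have KT : K^T = block_mx 1%:M 0 0 P'^T.
  by rewrite /K (@tr_block_mx _ 1 n 1 n) !trmx0 trmx1.
have KK : K *m K^T = 1%:M.
  rewrite KT /K (@mulmx_block _ 1 n 1 n 1 n) !mul0mx !mulmx0 !mulmx1.
  by rewrite !addr0 !add0r PP' -scalar_mx_block.
pose d : 'M[R]_(1 + n) := diag_mx (\row_i (a :: s)`_i).
have dE : d = block_mx a%:M 0 0 (diag_mx (\row_i s`_i)).
  rewrite /d -[LHS](@submxK _ 1 n 1 n).
  by congr block_mx; apply/matrixP => i j; rewrite !mxE ?ord1.
have BK : B = K^T *m d *m K.
  rewrite dE KT /K !(@mulmx_block _ 1 n 1 n 1 n).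
  rewrite !(mul0mx, mulmx0, mul1mx, mulmx1, addr0, add0r).
  by rewrite BE BE'.
exists (K *m Q); split.
  by rewrite trmx_mul symQ mulmxA -(mulmxA _ Q Q) QQ mulmx1.
by rewrite trmx_mul symQ {1}AE BK !mulmxA.
Qed.

End spectral.

(** * Power moments and quadratic forms in an eigenbasis *)

Section moments.
Variables (R : realType) (n : nat).

(** Chebyshev's sum inequality: the powers of the nonnegative [d l] are similarly ordered, so each
    product of differences in the symmetrized double sum is nonnegative, and that double sum is
    twice the gap. *)
Lemma sum_pow_mul_le (w d : 'I_n -> R) (i j : nat) :
  (forall l, 0 <= w l) -> (forall l, 0 <= d l) ->
  (\sum_l d l ^+ i * w l) * (\sum_l d l ^+ j * w l) <=
  (\sum_l d l ^+ 0 * w l) * (\sum_l d l ^+ (i + j) * w l).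
Proof.
move=> w0 d0.
have h : 0 <= \sum_l \sum_m
    w l * w m * ((d l ^+ i - d m ^+ i) * (d l ^+ j - d m ^+ j)).
  apply: sumr_ge0 => l _; apply: sumr_ge0 => m _.
  apply: mulr_ge0; first exact: mulr_ge0.
  case: (leP (d l) (d m)) => lm.
    by rewrite mulr_le0 // subr_le0 lerXn2r // nnegrE.
  by apply: mulr_ge0; rewrite subr_ge0 lerXn2r // ?nnegrE // ltW.
suff e : \sum_l \sum_m
    w l * w m * ((d l ^+ i - d m ^+ i) * (d l ^+ j - d m ^+ j)) =
    2 * ((\sum_l d l ^+ 0 * w l) * (\sum_l d l ^+ (i + j) * w l) -
    (\sum_l d l ^+ i * w l) * (\sum_l d l ^+ j * w l)).
  by move: h; rewrite e pmulr_rge0// subr_ge0.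
have E (F G : 'I_n -> R) : 2 * ((\sum_l F l) * (\sum_l G l)) =
    \sum_l \sum_m (F l * G m + F m * G l).
  have E' (F' G' : 'I_n -> R) : (\sum_l F' l) * (\sum_l G' l) =
      \sum_l \sum_m F' l * G' m.
    by rewrite mulr_suml; apply: eq_bigr => l _; rewrite mulr_sumr.
  rewrite mulr_natl mulr2n {2}[_ * _]mulrC !E' -big_split /=.
  apply: eq_bigr => l _; rewrite -big_split /=.
  by apply: eq_bigr => m _; rewrite [in LHS](mulrC (G l)).
rewrite mulrBr !E -sumrB.
apply: eq_bigr => l _; rewrite -sumrB.
by apply: eq_bigr => m _; rewrite !exprD expr0; ring.
Qed.

End moments.

Section diag_conj.
Variables (R : realType) (n : nat) (A P : 'M[R]_n) (d : 'I_n -> R).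
Hypothesis PP : P *m P^T = 1%:M.
Hypothesis AE : A = P^T *m diag_mx (\row_i d i) *m P.

Lemma diag_conj_expr m : A ^+ m = P^T *m diag_mx (\row_i d i ^+ m) *m P.
Proof.
elim: m => [|m IH].
  rewrite expr0 (_ : \row_i _ = const_mx 1); last first.
    by apply/rowP => i; rewrite !mxE.
  by rewrite diag_const_mx mulmx1 (mulmx1C PP).
rewrite exprS -[LHS]/(_ *m _) IH {1}AE.
rewrite -!mulmxA (mulmxA P) PP mul1mx (mulmxA (diag_mx _)) mulmx_diag.
congr (_ *m (diag_mx _ *m _)).
by apply/rowP => i; rewrite !mxE exprS.
Qed.

Lemma dot_diag_conj_expr m x :
  dot x (A ^+ m *m x) = \sum_i d i ^+ m * (P *m x) i 0 ^+ 2.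
Proof.
rewrite diag_conj_expr -!mulmxA dot_mulmx trmxK /dot.
by apply: eq_bigr => i _; rewrite mul_diag_mx !mxE; ring.
Qed.

Lemma dot_diag_conj x :
  dot x (A *m x) = \sum_i d i * (P *m x) i 0 ^+ 2.
Proof.
by rewrite -{1}(expr1 A) dot_diag_conj_expr; apply: eq_bigr.
Qed.

Lemma dot_orthomx x : dot x x = \sum_i (P *m x) i 0 ^+ 2.
Proof.
have := dot_diag_conj_expr 0 x; rewrite expr0 mul1mx => ->.
by apply: eq_bigr => i _; rewrite expr0 mul1r.
Qed.

Lemma mxtrace_diag_conj_expr m : \tr (A ^+ m) = \sum_i d i ^+ m.
Proof.
rewrite diag_conj_expr -mulmxA mxtrace_mulC -mulmxA PP mulmx1 mxtrace_diag.
by apply: eq_bigr => i _; rewrite mxE.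
Qed.

(** The [i]-th row of [P] is a unit eigenvector. Testing on it turns bounds on the quadratic form
    into bounds on the diagonal. *)
Lemma diag_conj_eig i : exists2 x, dot x x = 1 & dot x (A *m x) = d i.
Proof.
exists (P^T *m delta_mx i 0).
  by rewrite dot_mulmx trmxK mulmxA PP mul1mx dot_delta mxE !eqxx.
rewrite dot_diag_conj mulmxA PP mul1mx (bigD1 i)//= mxE !eqxx expr1n mulr1.
by rewrite big1 ?addr0// => j ji; rewrite mxE (negPf ji) expr0n mulr0.
Qed.

Lemma diag_conj_ge c :
  (forall x, c * dot x x <= dot x (A *m x)) -> forall i, c <= d i.
Proof.
by move=> h i; have [x x1 <-] := diag_conj_eig i; have := h x; rewrite x1 mulr1.
Qed.

Lemma diag_conj_le c :
  (forall x, dot x (A *m x) <= c * dot x x) -> forall i, d i <= c.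
Proof.
by move=> h i; have [x x1 <-] := diag_conj_eig i; have := h x; rewrite x1 mulr1.
Qed.

End diag_conj.

(** * Variational bounds for ordered eigenvalues *)

Section eigval.
Variables (R : realType).

Lemma size_spectrum n (A : 'M[R]_n) : A^T = A -> size (spectrum A) = n.
Proof.
move=> /spectrumP[_ cA]; apply/eqP; rewrite -eqSS -(size_char_poly A) cA.
by rewrite size_prod_XsubC.
Qed.

Lemma spectrum_diag_conj n (A : 'M[R]_n) : A^T = A ->
  exists P : 'M[R]_n, P *m P^T = 1%:M /\
    A = P^T *m diag_mx (\row_(i < n) eigval A i.+1) *m P.
Proof. by move=> symA; apply: spectral_real => //; have [] := spectrumP symA. Qed.

Lemma eigval_le n (A : 'M[R]_n) i j : A^T = A -> (i <= j < n)%N ->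
  eigval A j.+1 <= eigval A i.+1.
Proof.
move=> symA /andP[ij jn]; have [sA _] := spectrumP symA.
rewrite /eigval /=; apply: (@sorted_leq_nth _ >=%R) => //.
- by move=> y x z xy yz; apply: le_trans yz xy.
- exact: lexx.
- by rewrite inE size_spectrum// (leq_ltn_trans ij).
- by rewrite inE size_spectrum.
Qed.

Lemma eigval_top_frame n k (A : 'M[R]_n) : A^T = A -> (k <= n)%N ->
  exists W : 'M[R]_(n, k), W^T *m W = 1%:M /\
    A *m W = W *m diag_mx (\row_(i < k) eigval A i.+1).
Proof.
move=> symA kn; have [P [PP AE]] := spectrum_diag_conj symA.
pose w (i : 'I_k) : 'I_n := widen_ord kn i.
have winj : injective w by move=> i j [] ij; apply: val_inj.
pose W : 'M[R]_(n, k) := (rowsub w P)^T.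
have PW : P *m W = (rowsub w 1%:M)^T.
  by rewrite /W -[P in P *m _]trmxK -trmx_mul mul_rowsub_mx PP.
have WE : W = P^T *m (P *m W) by rewrite mulmxA (mulmx1C PP) mul1mx.
exists W; split.
  rewrite {2}WE mulmxA -trmx_mul PW trmxK; apply/matrixP => i j.
  rewrite mxE (bigD1 (w i))//= big1 => [|l li]; rewrite !mxE.
    by rewrite eqxx mul1r addr0 (inj_eq winj) eq_sym.
  by rewrite eq_sym (negPf li) mul0r.
rewrite [in LHS]AE [in RHS]WE -!mulmxA; congr (_ *m _); rewrite [in RHS]mulmxA.
rewrite PW; apply/matrixP => i j; rewrite mul_diag_mx mul_mx_diag !mxE mulrC.
by case: eqP => [<-|_]; rewrite ?mul0r.
Qed.

Lemma underdetermined m k (K : 'M[R]_(m, k)) : (m < k)%N ->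
  exists2 y : 'cV[R]_k, y != 0 & K *m y = 0.
Proof.
move=> mk; have : kermx K^T != 0.
  rewrite -mxrank_eq0 mxrank_ker subn_eq0 -ltnNge.
  by rewrite mxrank_tr (leq_ltn_trans (rank_leq_row K)).
case/rowV0Pn => v /sub_kermxP vK v0; exists v^T.
  by rewrite -(inj_eq trmx_inj) trmxK trmx0.
by apply: trmx_inj; rewrite trmx_mul trmxK trmx0.
Qed.

(** One half of the Courant-Fischer principle: the range of [W] has dimension [k + 1], so it
    contains a unit vector orthogonal to the [k] leading eigenvectors of [A]. Only eigenvalues from
    the [k + 1]-st on contribute to the form there. *)
Lemma eigval_frame_le n k (A : 'M[R]_n) (W : 'M[R]_(n, k.+1)) :
  A^T = A -> (k < n)%N -> W^T *m W = 1%:M ->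
  exists2 y : 'cV[R]_k.+1, dot y y = 1 &
    dot (W *m y) (A *m (W *m y)) <= eigval A k.+1.
Proof.
move=> symA kn WW; have [P [PP AE]] := spectrum_diag_conj symA.
pose w (i : 'I_k) : 'I_n := widen_ord (ltnW kn) i.
have [z z0 Kz] := underdetermined (rowsub w (P *m W)) (ltnSn k).
have zz := dot_gt0 z0.
pose y := (Num.sqrt (dot z z))^-1 *: z.
have yy : dot y y = 1.
  rewrite /y dotZl dotZr mulrA -expr2 exprVn sqr_sqrtr; last exact: ltW.
  by rewrite mulVf// gt_eqF.
have Py (i : 'I_n) : (i < k)%N -> (P *m (W *m y)) i 0 = 0.
  move=> ik; rewrite mulmxA /y -scalemxAr mxE.
  suff -> : (P *m W *m z) i 0 = 0 by rewrite mulr0.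
  have /colP/(_ (Ordinal ik)) := Kz; rewrite mul_rowsub_mx mxE [RHS]mxE => <-.
  by congr (_ _ _); apply: val_inj.
exists y => //; rewrite (dot_diag_conj PP AE).
have <- : eigval A k.+1 * dot (W *m y) (W *m y) = eigval A k.+1.
  by rewrite dot_mulmx mulmxA WW mul1mx yy mulr1.
rewrite (dot_orthomx PP AE) mulr_sumr; apply: ler_sum => i _.
have [ik|ki] := ltnP i k; first by rewrite Py// expr0n !mulr0.
by apply: ler_wpM2r; rewrite ?sqr_ge0// eigval_le// ki /=.
Qed.

(** The test space is spanned by leading eigenvectors of [A]: on it the form of [A] is at least its
    [k + 1]-st eigenvalue, while some unit vector in it keeps the form of [B] below that of [B]. *)
Lemma eigval_Weyl n k (A B : 'M[R]_n) c : A^T = A -> B^T = B ->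
  (k < n)%N -> (forall x, dot x x = 1 -> dot x ((A - B) *m x) <= c) ->
  eigval A k.+1 <= eigval B k.+1 + c.
Proof.
move=> symA symB kn AB.
have [W [WW WA]] := eigval_top_frame symA kn.
have [y yy yB] := eigval_frame_le symB kn WW.
have /AB : dot (W *m y) (W *m y) = 1 by rewrite dot_mulmx mulmxA WW mul1mx.
rewrite mulmxBl dotBr lerBlDr => h.
suff h' : eigval A k.+1 <= dot (W *m y) (A *m (W *m y)).
  by apply: (le_trans h'); apply: (le_trans h); rewrite addrC lerD2r.
rewrite dotC dot_mulmx dotC !mulmxA -(mulmxA _ A) WA mulmxA WW mul1mx -[leLHS]mulr1 -yy /dot mulr_sumr; apply: ler_sum => i _.
rewrite mul_diag_mx !mxE [leRHS]mulrCA -expr2; apply: ler_wpM2r; first exact: sqr_ge0.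
by apply: eigval_le => //; rewrite -ltnS ltn_ord.
Qed.

End eigval.

(** * A trace inequality for rank-one updates *)

(** Noncommutative factorization of a difference of powers; [a] and [b] are not assumed to commute,
    so the difference stays in the middle. *)
Lemma subrXX_telescope (S : pzRingType) (a b : S) m :
  a ^+ m - b ^+ m = \sum_(i < m) b ^+ (m.-1 - i) * (a - b) * a ^+ i.
Proof.
elim: m => [|m IH]; first by rewrite big_ord0 !expr0 subrr.
rewrite big_ord_recr /= subnn expr0 mul1r.
have -> : \sum_(i < m) b ^+ (m - i) * (a - b) * a ^+ i =
    b * (a ^+ m - b ^+ m).
  rewrite IH mulr_sumr; apply: eq_bigr => i _; rewrite !mulrA -exprS.
  by congr (b ^+ _ * _ * _); have := ltn_ord i; case: m {IH} i => //= m i h;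
     rewrite subSn.
by rewrite mulrBr mulrBl -!exprS addrC subrKA.
Qed.

Section rank_one_update.
Variables (R : realType) (k : nat) (A B : 'M[R]_k) (v : 'cV[R]_k) (eta : R).
Hypothesis symA : A^T = A.
Hypothesis symB : B^T = B.
Hypothesis eta0 : 0 <= eta.
Hypothesis AB : A = B + eta *: (v *m v^T).
Hypothesis A_ge0 : forall x, 0 <= dot x (A *m x).
Hypothesis B_ge0 : forall x, 0 <= dot x (B *m x).

Lemma quad_expr_ge0 (E : 'M[R]_k) m x : E^T = E ->
  (forall x, 0 <= dot x (E *m x)) -> 0 <= dot x (E ^+ m *m x).
Proof.
move=> symE E0; have [P [PP EE]] := spectrum_diag_conj symE.
rewrite (dot_diag_conj_expr PP EE); apply: sumr_ge0 => i _.
apply: mulr_ge0; last exact: sqr_ge0.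
apply: exprn_ge0; apply: (diag_conj_ge PP EE) => y; rewrite mul0r; exact: E0.
Qed.

Let a i := dot v (A ^+ i *m v).
Let b i := dot v (B ^+ i *m v).
Let T i j := dot v (A ^+ i *m (B ^+ j *m v)).

Let a_ge0 i : 0 <= a i. Proof. exact: quad_expr_ge0. Qed.
Let b_ge0 i : 0 <= b i. Proof. exact: quad_expr_ge0. Qed.

(* Peeling [A]'s off one at a time turns [a i = T i 0] into [b i = T 0 i]. *)
Let TS i j : T i.+1 j = T i j.+1 + eta * (a i * b j).
Proof.
rewrite /T exprSr -[A ^+ i * A]/(_ *m _) -mulmxA.
have -> : A *m (B ^+ j *m v) = B ^+ j.+1 *m v + (eta * b j) *: v.
  rewrite AB mulmxDl -scalemxAl mulmx_outer scalerA; congr (_ + _).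
  by rewrite exprS -[B * _]/(_ *m _) mulmxA.
by rewrite mulmxDr dotDr -scalemxAr dotZr mulrAC mulrA.
Qed.

Let T0 j : T 0 j = b j. Proof. by rewrite /T expr0 mul1mx. Qed.
Let Ta i : T i 0 = a i. Proof. by rewrite /T expr0 mul1mx. Qed.

Let T_ge i j : b (i + j)%N <= T i j.
Proof.
elim: i j => [|i IH] j; first by rewrite T0.
rewrite TS; apply: (@le_trans _ _ (T i j.+1)); first by rewrite addSnnS.
by rewrite lerDl !mulr_ge0.
Qed.

Let b_le_a i : b i <= a i. Proof. by rewrite -Ta -{1}(addn0 i). Qed.

Let aMa i j : a i * a j <= a 0%N * a (i + j)%N.
Proof.
have [P [PP AE]] := spectrum_diag_conj symA.
rewrite /a !(dot_diag_conj_expr PP AE).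
apply: sum_pow_mul_le => l; first exact: sqr_ge0.
by apply: (diag_conj_ge PP AE) => y; rewrite mul0r.
Qed.

(** Each peeled [A] costs [eta * (a i * b j)], which is at most [eta * (a i * a j)] and, by the
    Chebyshev bound [aMa], at most [eta] times the product of the zeroth and the [i + j]-th
    moments. *)
Let T_le i j : T i j <= b (i + j)%N + eta * i%:R * (a 0%N * a (i + j).-1).
Proof.
elim: i j => [|i IH] j; first by rewrite T0 mulr0 mul0r addr0.
rewrite TS; apply: (le_trans (lerD (IH _) (lexx _))).
rewrite addSn addnS /= -addrA lerD2l -natr1 mulrDr mulr1 mulrDl lerD2l.
apply: ler_wpM2l => //; apply: le_trans (aMa i j).
exact: ler_wpM2l.
Qed.

Lemma quad_expr_update n :
  a n - eta * n%:R * (a 0%N * a n.-1) <= b n.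
Proof. by rewrite lerBlDr -Ta; have := T_le n 0; rewrite addn0. Qed.

(** By cyclicity of the trace each telescoped term is [eta * T i (n - i)], and every such mixed
    moment dominates [b n]. This is what stands in for Golden-Thompson. *)
Lemma mxtrace_expr_update n :
  n.+1%:R * (eta * b n) <= \tr (A ^+ n.+1) - \tr (B ^+ n.+1).
Proof.
rewrite -raddfB /= subrXX_telescope raddf_sum /=.
rewrite -[X in X%:R](card_ord n.+1) mulr_natl -sumr_const.
apply: ler_sum => i _.
have -> : A - B = eta *: (v *m v^T) by rewrite AB addrC addKr.
rewrite -[X in \tr X]/(_ *m _ *m _) -mulmxA mxtrace_mulC -scalemxAl -scalemxAl.
rewrite linearZ /= ler_wpM2l//.
rewrite -!mulmxA mxtrace_mulC trace_mx11 -!mulmxA -dotE.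
by have := T_ge i (n - i); rewrite subnKC// -ltnS.
Qed.

(** The trace drop is bounded below by [b] at exponent [n + 1], hence by moments of [A] alone. As
    the spectrum of [A] lies between [1 - kappa] and [1], all these moments compare with the one at
    [n + 2], the division by [(1 - kappa) ^+ 2] paying for two missing powers. *)
Lemma mxtrace_expr_update_le n kappa l :
  kappa < 1 ->
  (forall x, (1 - kappa) * dot x x <= dot x (A *m x)) ->
  (forall x, dot x (A *m x) <= dot x x) -> dot v v <= l ->
  \tr (B ^+ n.+2) <= \tr (A ^+ n.+2) - n.+2%:R * eta *
    (1 - n.+2%:R * eta * l / (1 - kappa) ^+ 2) * a n.+2.
Proof.
move=> k1 Age Ale vl.
have [P [PP AE]] := spectrum_diag_conj symA.
have dge := diag_conj_ge PP AE Age.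
have dle (i : 'I_k) : eigval A i.+1 <= 1.
  by move: i; apply: (diag_conj_le PP AE) => x; rewrite mul1r.
have k0 : 0 < 1 - kappa by rewrite subr_gt0.
have d0 (i : 'I_k) : 0 <= eigval A i.+1 by apply: le_trans (dge i); apply: ltW.
have h1 : a n.+2 <= a n.+1.
  rewrite /a !(dot_diag_conj_expr PP AE); apply: ler_sum => i _.
  apply: ler_wpM2r; first exact: sqr_ge0.
  by rewrite exprS ler_piMl// exprn_ge0.
have h2 : (1 - kappa) ^+ 2 * a n <= a n.+2.
  rewrite /a !(dot_diag_conj_expr PP AE) mulr_sumr; apply: ler_sum => i _.
  rewrite mulrA; apply: ler_wpM2r; first exact: sqr_ge0.
  rewrite -[n.+2]addn2 exprD mulrC; apply: ler_wpM2l; first exact: exprn_ge0.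
  by rewrite lerXn2r// nnegrE // ltW.
rewrite lerBrDl -lerBrDr.
apply: le_trans (mxtrace_expr_update n.+1).
rewrite -!mulrA; apply: ler_wpM2l => //; apply: ler_wpM2l => //.
apply: le_trans (quad_expr_update n.+1).
rewrite mulrBl mul1r; apply: lerB => //=.
have -> : a 0%N = dot v v by rewrite /a expr0 mul1mx.
have h3 : a n <= a n.+2 / (1 - kappa) ^+ 2.
  by rewrite ler_pdivlMr ?exprn_gt0// mulrC.
have -> : n.+2%:R * (eta * (l / (1 - kappa) ^+ 2)) * a n.+2 =
    eta * n.+2%:R * (l * (a n.+2 / (1 - kappa) ^+ 2)) by ring.
apply: ler_pM; rewrite ?mulr_ge0 ?dot_ge0 //.
  by apply: ler_wpM2l => //; rewrite ler_nat.
by apply: ler_pM; rewrite ?dot_ge0.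
Qed.

End rank_one_update.

(** * Bounded random variables and independence *)

Section weighted_pushforward.
Local Open Scope ereal_scope.
Context d1 d2 (T1 : measurableType d1) (T2 : measurableType d2) (R : realType).
Variables (mu : {measure set T1 -> \bar R}) (nu : {measure set T2 -> \bar R}).
Variables (phi : T1 -> T2) (W : T1 -> R).
Hypothesis mphi : measurable_fun setT phi.
Hypothesis mW : measurable_fun setT W.
Hypothesis W0 : forall x, (0 <= W x)%R.
Hypothesis nuE : forall B, measurable B -> nu B = \int[mu]_(x in phi @^-1` B) (W x)%:E.

Import HBNNSimple.

(** The identity on sets passes to simple functions by linearity and to nonnegative functions by
    monotone convergence. It serves both for independence, with [W] a product of the other factors,
    and for densities, with [phi] the identity. *)
Lemma ge0_integral_weighted_pushforward (h : T2 -> \bar R) :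
  measurable_fun setT h -> (forall y, 0 <= h y) ->
  \int[nu]_y h y = \int[mu]_x (h (phi x) * (W x)%:E).
Proof.
move=> mh h0; pose f_ := nnsfun_approx measurableT mh.
have mf n : measurable_fun setT (fun x => (f_ n (phi x))%:E).
  by apply/measurable_EFinP; apply: measurableT_comp.
have cvgf y : (f_ n y)%:E @[n --> \oo] --> h y.
  by apply: (@cvg_nnsfun_approx _ _ _ _ measurableT _ mh) => // x _; apply: h0.
transitivity (limn (fun n => \int[nu]_y (f_ n y)%:E)).
  rewrite -monotone_convergence//.
  - by apply: eq_integral => y _; apply/esym/cvg_lim.
  - by move=> n; exact/measurable_EFinP/measurable_funP.
  - by move=> n y _; rewrite lee_fin.
  - by move=> y _ m n mn; rewrite lee_fin; exact/lefP/nd_nnsfun_approx.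
transitivity (limn (fun n => \int[mu]_x ((f_ n (phi x))%:E * (W x)%:E))); last first.
  rewrite -monotone_convergence//.
  - by apply: eq_integral => x _; apply/cvg_lim => //; exact: cvgeZr.
  - by move=> n; apply: emeasurable_funM => //; exact/measurable_EFinP.
  - by move=> n x _; apply: mule_ge0; rewrite lee_fin.
  - move=> x _ m n mn; apply: lee_wpmul2r; rewrite lee_fin//.
    exact/lefP/nd_nnsfun_approx.
congr (limn _); apply/funext => n; rewrite integralT_nnsfun sintegralE.
have mphiI B : measurable B -> measurable (phi @^-1` B).
  by move=> mB; rewrite -[X in measurable X]setTI; exact: mphi.
have mpre r : measurable (f_ n @^-1` [set r]) by exact: measurable_sfunP.
transitivity (\sum_(r \in range (f_ n))
    \int[mu]_x ((r * \1_(f_ n @^-1` [set r]) (phi x))%:E * (W x)%:E)).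
  apply: eq_fsbigr => r /[!inE] -[y _ <-{r}].
  under eq_integral do rewrite EFinM -muleA.
  rewrite ge0_integralZl//; last 3 first.
  - apply: emeasurable_funM; last exact/measurable_EFinP.
    apply/measurable_EFinP.
    exact: (measurableT_comp (measurable_indic (mpre _)) mphi).
  - by move=> x _; rewrite -EFinM lee_fin mulr_ge0// indicE.
  - by rewrite lee_fin.
  congr (_ * _); rewrite nuE// integral_mkcond.
  apply: eq_integral => x _; rewrite patchE indicE.
  rewrite (_ : (x \in _) = (phi x \in f_ n @^-1` [set f_ n y])); last first.
    by apply/idP/idP => /set_mem ?; exact: mem_set.
  by case: ifP => _; rewrite ?mul1e ?mul0e.
rewrite -ge0_integral_fsum//.
- apply: eq_integral => x _; rewrite fimfunE -fsumEFin//.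
  rewrite ge0_mule_fsuml// => r; exact: nnfun_muleindic_ge0.
- move=> r; apply: emeasurable_funM; last exact/measurable_EFinP.
  apply/measurable_EFinP; apply: measurable_funM => //.
  exact: (measurableT_comp (measurable_indic (mpre _)) mphi).
- move=> r x _; apply: mule_ge0; last by rewrite lee_fin.
  by rewrite EFinM; exact: nnfun_muleindic_ge0.
Qed.

End weighted_pushforward.

Section bounded_mfun.
Context d (T : measurableType d) (R : realType).

(** An algebra of functions integrable for every probability, so that integrals of polynomial
    expressions can be split without further integrability conditions. *)
Definition bounded_mfun (Y : T -> R) :=
  measurable_fun setT Y /\ exists K, forall w, `|Y w| <= K.

Lemma bounded_mfun_cst c : bounded_mfun (fun=> c).
Proof. by split; [exact: measurable_cst|exists `|c|]. Qed.

Lemma bounded_mfunD Y Z : bounded_mfun Y -> bounded_mfun Z ->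
  bounded_mfun (fun w => Y w + Z w).
Proof.
move=> [mY [K YK]] [mZ [K' ZK]]; split; first exact: measurable_funD.
by exists (K + K') => w; rewrite (le_trans (ler_normD _ _))// lerD.
Qed.

Lemma bounded_mfunM Y Z : bounded_mfun Y -> bounded_mfun Z ->
  bounded_mfun (fun w => Y w * Z w).
Proof.
move=> [mY [K YK]] [mZ [K' ZK]]; split; first exact: measurable_funM.
by exists (K * K') => w; rewrite normrM ler_pM.
Qed.

Lemma bounded_mfunZ c Y : bounded_mfun Y -> bounded_mfun (fun w => c * Y w).
Proof. by move=> bY; apply: bounded_mfunM => //; exact: bounded_mfun_cst. Qed.

Lemma bounded_mfunB Y Z : bounded_mfun Y -> bounded_mfun Z ->
  bounded_mfun (fun w => Y w - Z w).
Proof.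
move=> bY bZ; apply: bounded_mfunD => //.
have := bounded_mfunZ (-1) bZ.
by congr bounded_mfun; apply/funext => w; rewrite mulN1r.
Qed.

Lemma bounded_mfun_sum (I : Type) (r : seq I) (F : I -> T -> R) :
  (forall i, bounded_mfun (F i)) -> bounded_mfun (fun w => \sum_(i <- r) F i w).
Proof.
move=> bF; elim: r => [|i r IH].
  under [X in bounded_mfun X]funext do rewrite big_nil.
  exact: bounded_mfun_cst.
under [X in bounded_mfun X]funext do rewrite big_cons.
exact: bounded_mfunD.
Qed.

Lemma bounded_mfun_prod (I : Type) (r : seq I) (Q : pred I) (F : I -> T -> R) :
  (forall i, bounded_mfun (F i)) ->
  bounded_mfun (fun w => \prod_(i <- r | Q i) F i w).
Proof.
move=> bF; elim: r => [|i r IH].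
  under [X in bounded_mfun X]funext do rewrite big_nil.
  exact: bounded_mfun_cst.
under [X in bounded_mfun X]funext do rewrite big_cons.
by case: (Q i) => //; exact: bounded_mfunM.
Qed.

Lemma bounded_mfun_indic (B : set T) : measurable B -> bounded_mfun \1_B.
Proof.
move=> mB; split; first exact: measurable_indic.
by exists 1 => w; rewrite indicE; case: (_ \in _); rewrite ?normr1 ?normr0.
Qed.

Variable P : probability T R.

Lemma bounded_mfun_integrable Y : bounded_mfun Y ->
  P.-integrable setT (EFin \o Y).
Proof.
move=> [mY [K YK]]; apply: measurable_bounded_integrable => //.
  by rewrite ltey_eq fin_num_measure.
exists K; split; first exact: num_real.
by move=> M KM w _; apply: le_trans (YK w) _; exact: ltW.
Qed.

Lemma EFin_Rintegral Y : bounded_mfun Y ->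
  (\int[P]_w (Y w)%:E)%E = (\int[P]_w Y w)%:E.
Proof.
move=> bY; rewrite fineK//; apply: integrable_fin_num => //.
exact: bounded_mfun_integrable.
Qed.

Lemma Rintegral_probability_cst c : \int[P]_w (fun=> c) w = c.
Proof.
rewrite Rintegral_cst// (_ : fine _ = 1) ?mulr1//.
by transitivity (fine (1%E : \bar R)) => //; congr fine; exact: probability_setT.
Qed.

Lemma Rintegral_bigsum (I : Type) (r : seq I) (F : I -> T -> R) :
  (forall i, bounded_mfun (F i)) ->
  \int[P]_w (\sum_(i <- r) F i w) = \sum_(i <- r) \int[P]_w F i w.
Proof.
move=> bF; elim: r => [|i r IH].
  under eq_Rintegral do rewrite big_nil.
  by rewrite big_nil Rintegral_probability_cst.
under eq_Rintegral do rewrite big_cons.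
rewrite big_cons RintegralD ?IH//; first exact: bounded_mfun_integrable.
by apply: bounded_mfun_integrable; exact: bounded_mfun_sum.
Qed.

End bounded_mfun.

Lemma bounded_mfun_comp d d' (T : measurableType d) (T' : measurableType d')
    (R : realType) (h : T' -> R) (X : T -> T') :
  bounded_mfun h -> measurable_fun setT X -> bounded_mfun (h \o X).
Proof.
move=> [mh [K hK]] mX; split; first exact: measurableT_comp.
by exists K => w; apply: hK.
Qed.

Section independence.
Context d d' (Omega : measurableType d) (T : measurableType d') (R : realType).
Variables (P : probability Omega R) (M : nat) (X : 'I_M -> {RV P >-> T}).
Hypothesis indX : mutually_independent X.

Let mX i : measurable_fun setT (X i). Proof. exact: measurable_funP. Qed.

Let bX i (h : T -> R) : bounded_mfun h -> bounded_mfun (fun w => h (X i w)).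
Proof. by move=> bh; exact: (bounded_mfun_comp bh (mX i)). Qed.

Let Rintegral_prod_indic (B : 'I_M -> set T) : (forall i, measurable (B i)) ->
  \int[P]_w (\prod_i \1_(B i) (X i w)) =
  \prod_i \int[P]_w \1_(B i) (X i w) :> R.
Proof.
move=> mB.
have mXB i : measurable (X i @^-1` B i).
  by rewrite -[Y in measurable Y]setTI; exact: mX.
have E A : measurable A -> (\int[P]_w \1_A w = fine (P A) :> R).
  by move=> mA; rewrite /Rintegral integral_indic// setIT.
transitivity (\int[P]_w
    \1_(\bigcap_(j in [set: 'I_M]) X j @^-1` B j) w : R).
  apply: eq_Rintegral => w _; rewrite indicE.
  case: (boolP (w \in _)) => [/set_mem h|/negP h].
    by rewrite big1// => i _; rewrite indicE mem_set//; exact: h.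
  have [i hi] : exists i, ~ B i (X i w).
    by apply/existsNP => h'; apply: h; apply/mem_set => i _; exact: h'.
  by rewrite (bigD1 i)//= indicE memNset// mul0r.
rewrite E; last by apply: fin_bigcap_measurable => // i _; exact: mXB.
rewrite indX//.
have -> : (\prod_(j < M) P (X j @^-1` B j) =
    (\prod_(j < M) fine (P (X j @^-1` B j)))%:E)%E.
  rewrite -prodEFin; apply: eq_bigr => i _; rewrite fineK//.
  by rewrite fin_num_measure.
apply: eq_bigr => i _; rewrite -E//; apply: eq_Rintegral => w _.
Qed.

(** The product rule is extended from indicators to functions one factor at a time: at stage [m] the
    factors of index at least [m] are still indicators. *)
Let Rintegral_prod_rec m (h : 'I_M -> T -> R) :
  (forall i, bounded_mfun (h i)) -> (forall i t, 0 <= h i t) ->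
  (forall i : 'I_M, (m <= i)%N -> exists2 B, measurable B & h i = \1_B) ->
  \int[P]_w (\prod_i h i (X i w)) = \prod_i \int[P]_w h i (X i w).
Proof.
elim: m h => [|m IH] h bh h0 hi.
  have /choice[B hB] : forall i, exists B, measurable B /\ h i = \1_B.
    by move=> i; have [B] := hi i (leq0n _); exists B.
  transitivity (\int[P]_w (\prod_i \1_(B i) (X i w))).
    by apply: eq_Rintegral => w _; apply: eq_bigr => i _; rewrite (hB i).2.
  rewrite Rintegral_prod_indic => [|i]; last exact: (hB i).1.
  by apply: eq_bigr => i _; rewrite (hB i).2.
have [Mm|mM] := leqP M m.
  by apply: IH => // i mi; have := leq_trans Mm mi; rewrite leqNgt ltn_ord.
pose i0 := Ordinal mM.
pose W w := \prod_(i | i != i0) h i (X i w).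
have bW : bounded_mfun W by apply: bounded_mfun_prod => i; exact: bX.
have W0 w : 0 <= W w by apply: prodr_ge0.
pose c := \prod_(i | i != i0) \int[P]_w h i (X i w).
have c0 : 0 <= c by apply: prodr_ge0 => i _; exact: Rintegral_ge0.
have step g : bounded_mfun g -> (forall t, 0 <= g t) ->
    (exists2 B, measurable B & g = \1_B) ->
    \int[P]_w (g (X i0 w) * W w) = \int[P]_w g (X i0 w) * c.
  (* With an indicator [g] put into slot [i0], the induction hypothesis applies and shows how the
     remaining factors act on sets. *)
  move=> bg g0 gB; pose h' i := if i == i0 then g else h i.
  have h'0 : h' i0 = g by rewrite /h' eqxx.
  have := IH h'; rewrite (bigD1 i0)//= h'0.
  have -> : \prod_(i | i != i0) \int[P]_w h' i (X i w) = c.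
    by apply: eq_bigr => i /negPf ii0; rewrite /h' ii0.
  move=> <-.
  - apply: eq_Rintegral => w _; rewrite (bigD1 i0)//= h'0.
    by congr (_ * _); apply: eq_bigr => i /negPf ii0; rewrite /h' ii0.
  - by move=> i; rewrite /h'; case: ifP.
  - by move=> i t; rewrite /h'; case: ifP.
  - move=> i mi; rewrite /h'; case: eqP => // /eqP ii0; apply: hi.
    by rewrite ltn_neqAle mi andbT eq_sym.
(* The law of [X i0] reweighted by the other factors is a multiple of itself. *)
pose nu : {measure set T -> \bar R} :=
  mscale (NngNum c0) (distribution P (X i0)).
have nuE B : measurable B ->
    nu B = (\int[P]_(w in X i0 @^-1` B) (W w)%:E)%E.
  move=> mB; have bB := @bounded_mfun_indic _ T R _ mB.
  transitivity (\int[P]_w (\1_B (X i0 w) * W w)%:E)%E; last first.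
    rewrite [RHS]integral_mkcond; apply: eq_integral => w _.
    rewrite patchE indicE.
    rewrite (_ : (w \in _) = (X i0 w \in B)); last first.
      by apply/idP/idP => /set_mem ?; exact: mem_set.
    by case: ifP => _; rewrite ?mul1r ?mul0r.
  rewrite EFin_Rintegral; last by apply: bounded_mfunM => //; exact: bX.
  rewrite step//; last by exists B.
  rewrite EFinM -EFin_Rintegral; last exact: bX.
  rewrite /nu /mscale /= muleC; congr (_ * _)%E.
  rewrite -[RHS]/(\int[P]_w ((EFin \o \1_B) \o X i0) w)%E.
  rewrite -[RHS]ge0_integral_distribution//.
  - by rewrite integral_indic// setIT.
  - by apply/measurable_EFinP; case: bB.
  - by move=> y; rewrite lee_fin.
rewrite [RHS](bigD1 i0)//= -/c.
have := @ge0_integral_weighted_pushforward _ _ _ _ _ P nu (X i0) W (mX i0)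
  bW.1 W0 nuE (EFin \o h i0).
rewrite ge0_integral_mscale//=; last 2 first.
- by apply/measurable_EFinP; case: (bh i0).
- by move=> x _; rewrite lee_fin.
rewrite ge0_integral_distribution//; last 2 first.
- by apply/measurable_EFinP; case: (bh i0).
- by move=> x; rewrite lee_fin.
rewrite /= EFin_Rintegral; last exact: bX.
move=> E; transitivity (\int[P]_w (h i0 (X i0 w) * W w)).
  by apply: eq_Rintegral => w _; rewrite (bigD1 i0).
rewrite mulrC; apply: EFin_inj; rewrite EFinM E//; last 2 first.
- by apply/measurable_EFinP; case: (bh i0).
- by move=> x; rewrite lee_fin.
by rewrite -EFin_Rintegral//; apply: bounded_mfunM => //; exact: bX.
Qed.

Lemma Rintegral_prod_independent (h : 'I_M -> T -> R) :
  (forall i, bounded_mfun (h i)) -> (forall i t, 0 <= h i t) ->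
  \int[P]_w (\prod_i h i (X i w)) = \prod_i \int[P]_w h i (X i w).
Proof.
move=> bh h0; apply: (@Rintegral_prod_rec M) => // i.
by rewrite leqNgt ltn_ord.
Qed.

End independence.

(** * Polynomials in the earlier samples *)

Section past.
Context d d' (Omega : measurableType d) (T : measurableType d') (R : realType).
Variables (P : probability Omega R) (M : nat) (X : 'I_M -> {RV P >-> T}).

(* Polynomials in bounded functions of the [X i] with [i < j], presented as sums
   of products of nonnegative factors; the factors of index at least [j] are
   frozen to [1]. *)
Inductive past (j : nat) : (Omega -> R) -> Prop :=
| past_prod (c : R) (h : 'I_M -> T -> R) :
    (forall i, bounded_mfun (h i)) -> (forall i t, 0 <= h i t) ->
    (forall i : 'I_M, (j <= i)%N -> h i = fun=> 1) ->
    past j (fun w => c * \prod_i h i (X i w))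
| past_add Y Z : past j Y -> past j Z -> past j (fun w => Y w + Z w).

Let mX i : measurable_fun setT (X i). Proof. exact: measurable_funP. Qed.

Let bX i (h : T -> R) : bounded_mfun h -> bounded_mfun (fun w => h (X i w)).
Proof. by move=> bh; exact: (bounded_mfun_comp bh (mX i)). Qed.

Lemma past_bounded j Y : past j Y -> bounded_mfun Y.
Proof.
elim=> {Y} [c h bh _ _|Y Z _ bY _ bZ]; last exact: bounded_mfunD.
by apply: bounded_mfunZ; apply: bounded_mfun_prod => i; exact: bX.
Qed.

Lemma past_cst j c : past j (fun=> c).
Proof.
have := @past_prod j c (fun _ _ => 1) (fun _ => bounded_mfun_cst _ 1)
  (fun _ _ => ler01) (fun _ _ => erefl).
by congr past; apply/funext => w; rewrite big1// mulr1.
Qed.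

Lemma past_mul j Y Z : past j Y -> past j Z -> past j (fun w => Y w * Z w).
Proof.
move=> pY pZ; elim: pY => {Y} [c h bh h0 h1|Y Y' _ pY _ pY']; last first.
  have := past_add pY pY'.
  by congr past; apply/funext => w; rewrite mulrDl.
elim: pZ => {Z} [c' h' bh' h'0 h'1|Z Z' _ pZ _ pZ']; last first.
  have := past_add pZ pZ'.
  by congr past; apply/funext => w; rewrite mulrDr.
have := @past_prod j (c * c') (fun i t => h i t * h' i t).
move/(_ (fun i => bounded_mfunM (bh i) (bh' i))).
move/(_ (fun i t => mulr_ge0 (h0 i t) (h'0 i t))).
have h2 (i : 'I_M) : (j <= i)%N -> (fun t => h i t * h' i t) = fun=> 1.
  by move=> ji; apply/funext => t; rewrite h1// h'1// mulr1.
move/(_ h2); congr past; apply/funext => w.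
by rewrite big_split /= mulrACA.
Qed.

Lemma past_sum j (I : Type) (r : seq I) (F : I -> Omega -> R) :
  (forall i, past j (F i)) -> past j (fun w => \sum_(i <- r) F i w).
Proof.
move=> pF; elim: r => [|i r IH].
  under [Y in past _ Y]funext do rewrite big_nil.
  exact: past_cst.
under [Y in past _ Y]funext do rewrite big_cons.
exact: past_add.
Qed.

(** A bounded factor of arbitrary sign is made nonnegative by adding its bound [K], which is then
    removed by a constant term. *)
Lemma past_var j (i : 'I_M) h : (i < j)%N -> bounded_mfun h ->
  past j (fun w => h (X i w)).
Proof.
move=> ij bh; have [mh [K hK]] := bh.
pose g k (t : T) := if k == i then h t + K else 1.
have bg k : bounded_mfun (g k).
  rewrite /g; case: (k == i); last exact: bounded_mfun_cst.
  by apply: bounded_mfunD => //; exact: bounded_mfun_cst.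
have g0 k t : 0 <= g k t.
  rewrite /g; case: ifP => // _.
  by rewrite -lerBlDr sub0r; have := hK t; rewrite ler_norml => /andP[].
have g1 (k : 'I_M) : (j <= k)%N -> g k = fun=> 1.
  move=> jk; apply/funext => t; rewrite /g; case: eqP => // ki.
  by move: (leq_trans ij jk); rewrite ki ltnn.
have := past_add (@past_prod j 1 g bg g0 g1) (past_cst j (- K)).
congr past; apply/funext => w; rewrite (bigD1 i)//= big1 => [|k /negPf ki].
  by rewrite /g eqxx mulr1 mul1r addrK.
by rewrite /g ki.
Qed.

Hypothesis indX : mutually_independent X.

(** After shifting [h] to the nonnegative [g] and splitting the sum, slot [j] of each product is
    frozen to [1]; placing [g] there gives a full product, to which the product rule applies. *)
Lemma past_independent (j : 'I_M) Y h : past j Y -> bounded_mfun h ->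
  \int[P]_w (Y w * h (X j w)) = \int[P]_w Y w * \int[P]_w h (X j w).
Proof.
move=> pY bh; have [mh [K hK]] := bh.
pose g (t : T) := h t + K.
have bg : bounded_mfun g.
  by apply: bounded_mfunD => //; exact: bounded_mfun_cst.
have g0 t : 0 <= g t.
  by rewrite -lerBlDr sub0r; have := hK t; rewrite ler_norml => /andP[].
have int Z : bounded_mfun Z -> P.-integrable setT (EFin \o Z).
  exact: bounded_mfun_integrable.
suff H : \int[P]_w (Y w * g (X j w)) = \int[P]_w Y w * \int[P]_w g (X j w).
  have bY := past_bounded pY.
  have -> : \int[P]_w (Y w * h (X j w)) =
      \int[P]_w (Y w * g (X j w) - K * Y w).
    by apply: eq_Rintegral => w _; rewrite /g; ring.
  rewrite RintegralB//; last 2 first.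
  - by apply: int; apply: bounded_mfunM => //; exact: bX.
  - by apply: int; exact: bounded_mfunZ.
  rewrite RintegralZl//; last exact: int.
  rewrite H /g RintegralD//; last 2 first.
  - by apply: int; exact: bX.
  - by apply: int; exact: bounded_mfun_cst.
  by rewrite Rintegral_probability_cst; ring.
elim: pY => {Y} [c u bu u0 u1|Y Z pY IHY pZ IHZ]; last first.
  have bY := past_bounded pY; have bZ := past_bounded pZ.
  rewrite RintegralD//; last 2 first.
  - exact: int.
  - exact: int.
  rewrite mulrDl -IHY -IHZ -RintegralD//; last 2 first.
  - by apply: int; apply: bounded_mfunM => //; exact: bX.
  - by apply: int; apply: bounded_mfunM => //; exact: bX.
  by apply: eq_Rintegral => w _; rewrite mulrDl.
pose u' i := if i == j then g else u i.
have u'j : u' j = g by rewrite /u' eqxx.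
have u'N i : i != j -> u' i = u i by rewrite /u' => /negPf ->.
have bu' i : bounded_mfun (u' i) by rewrite /u'; case: ifP.
have u'0 i t : 0 <= u' i t by rewrite /u'; case: ifP.
have bp v : (forall i, bounded_mfun (v i)) ->
    bounded_mfun (fun w => \prod_i (v i (X i w) : R)).
  by move=> bv; apply: bounded_mfun_prod => i; exact: bX.
have -> : \int[P]_w (c * \prod_i u i (X i w) * g (X j w)) =
    \int[P]_w (c * \prod_i u' i (X i w)).
  apply: eq_Rintegral => w _; rewrite (bigD1 j)//= [in RHS](bigD1 j)//= u'j.
  rewrite u1// mul1r -mulrA; congr (_ * _); rewrite mulrC; congr (_ * _).
  by apply: eq_bigr => i ij; rewrite u'N.
rewrite !RintegralZl//; [|exact: int (bp _ _)|exact: int (bp _ _)].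
rewrite !Rintegral_prod_independent// -mulrA; congr (_ * _).
rewrite (bigD1 j)//= [in RHS](bigD1 j)//= u'j u1//.
rewrite Rintegral_probability_cst mul1r mulrC; congr (_ * _).
by apply: eq_bigr => i ij; rewrite u'N.
Qed.

End past.

(** * Expectations through the density *)

Section density.
Variables (R : realType) (n : nat) (rho : borelRn R n -> R).
Context d (Omega : measurableType d) (P : probability Omega R).
Variable X : {RV P >-> borelRn R n}.
Hypothesis rho_pd : prob_density rho.
Hypothesis Xrho : has_density X rho.

(** The nonnegative case is a weighted pushforward along the identity. A bounded function is reduced
    to it by adding its bound [K], whose contribution is [K] on both sides because [rho] has total
    mass one. *)
Lemma Rintegral_density (h : borelRn R n -> R) : bounded_mfun h ->
  \int[P]_w h (X w) = \int[lebesgueRn R n]_x (h x * rho x).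
Proof.
have [mrho rho0 rho1] := rho_pd.
have mX : measurable_fun setT X by exact: measurable_funP.
have irho : (lebesgueRn R n).-integrable setT (EFin \o rho).
  apply/integrableP; split; first exact/measurable_EFinP.
  under eq_integral do rewrite /= ger0_norm//.
  by rewrite rho1 ltry.
have ige0 (g : borelRn R n -> R) : bounded_mfun g -> (forall x, 0 <= g x) ->
    (\int[P]_w (g (X w))%:E = \int[lebesgueRn R n]_x (g x * rho x)%:E)%E.
  move=> [mg _] g0.
  have mg' : measurable_fun setT (EFin \o g) by exact/measurable_EFinP.
  have := @ge0_integral_weighted_pushforward _ _ _ _ _ (lebesgueRn R n)
    (distribution P X) id rho (@measurable_id _ _ _) mrho rho0 Xrho
    (EFin \o g) mg' g0.
  by rewrite ge0_integral_distribution.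
move=> bh; have [mh [K hK]] := bh.
pose g t := h t + K.
have bg : bounded_mfun g.
  by apply: bounded_mfunD => //; exact: bounded_mfun_cst.
have g0 t : 0 <= g t.
  by rewrite -lerBlDr sub0r; have := hK t; rewrite ler_norml => /andP[].
have intP (Z : borelRn R n -> R) : bounded_mfun Z ->
    P.-integrable setT (EFin \o (Z \o X)).
  by move=> bZ; apply: bounded_mfun_integrable; exact: bounded_mfun_comp.
have intg : (lebesgueRn R n).-integrable setT (EFin \o (fun x => g x * rho x)).
  apply/integrableP; split.
    by apply/measurable_EFinP; apply: measurable_funM => //; exact: bg.1.
  under eq_integral do rewrite /= ger0_norm ?mulr_ge0//.
  rewrite -ige0// EFin_Rintegral ?ltry//.
  exact: (bounded_mfun_comp bg mX).
transitivity (\int[P]_w (g (X w)) - K).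
  rewrite /g RintegralD//; last 2 first.
  - exact: (intP _ bh).
  - exact: (intP _ (bounded_mfun_cst _ K)).
  by rewrite Rintegral_probability_cst addrK.
transitivity (\int[lebesgueRn R n]_x (g x * rho x - K * rho x)); last first.
  by apply: eq_Rintegral => x _; rewrite /g; ring.
rewrite RintegralB//; last first.
  have := integrableZl measurableT K irho.
  by congr integrable.
rewrite RintegralZl// /Rintegral rho1 /= mulr1; congr (_ - _).
by rewrite ige0.
Qed.

End density.

(** * The Chernoff bound *)

Section partial_gram.
Variables (R : realType) (k M : nat) (v : 'I_M -> 'cV[R]_k) (eta l : R).
Hypothesis eta0 : 0 <= eta.
Hypothesis vl : forall i, dot (v i) (v i) <= l.

(** With [eta = theta / N] this is the matrix [A_j] whose [N]-th power replaces the exponential. *)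
Definition partial_gram (j : nat) : 'M[R]_k :=
  1%:M - eta *: \sum_(i < M | (i < j)%N) v i *m (v i)^T.

Lemma partial_gram_sym j : (partial_gram j)^T = partial_gram j.
Proof.
rewrite /partial_gram linearB /= trmx1 linearZ /= linear_sum /=.
by congr (_ - _ *: _); apply: eq_bigr => i _; rewrite trmx_mul trmxK.
Qed.

Lemma partial_gram0 : partial_gram 0 = 1%:M.
Proof. by rewrite /partial_gram big_pred0 ?scaler0 ?subr0. Qed.

Lemma partial_gramS (j : 'I_M) :
  partial_gram j = partial_gram j.+1 + eta *: (v j *m (v j)^T).
Proof.
rewrite /partial_gram -addrA; congr (_ + _).
rewrite [in RHS](bigD1 j)//= scalerDr opprD addrAC addNr add0r.
congr (- (_ *: _)); apply: eq_bigl => i.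
by rewrite ltnS ltn_neqAle andbC.
Qed.

Lemma dot_partial_gram j x : dot x (partial_gram j *m x) =
  dot x x - eta * \sum_(i < M | (i < j)%N) dot (v i) x ^+ 2.
Proof.
rewrite mulmxBl mul1mx dotBr -scalemxAl dotZr mulmx_suml dot_sumr.
congr (_ - _ * _); apply: eq_bigr => i _.
by rewrite mulmx_outer dotZr (dotC x) expr2.
Qed.

Lemma dot_partial_gram_le j x : dot x (partial_gram j *m x) <= dot x x.
Proof.
rewrite dot_partial_gram gerBl mulr_ge0// sumr_ge0// => i _.
exact: sqr_ge0.
Qed.

Lemma dot_partial_gram_ge j x :
  (1 - eta * (M%:R * l)) * dot x x <= dot x (partial_gram j *m x).
Proof.
rewrite dot_partial_gram mulrBl mul1r lerB// -mulrA ler_wpM2l//.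
have h i : dot (v i) x ^+ 2 <= l * dot x x.
  apply: (le_trans (dot_CauchySchwarz _ _)).
  by apply: ler_wpM2r (vl i); exact: dot_ge0.
apply: (@le_trans _ _ (\sum_(i < M) dot (v i) x ^+ 2)).
  rewrite big_mkcond /=; apply: ler_sum => i _.
  by case: ifP => // _; exact: sqr_ge0.
apply: le_trans (ler_sum _ (fun i _ => h i)) _.
by rewrite sumr_const card_ord -(mulr_natl (l * _)) mulrA.
Qed.

(** The form at a unit vector is a weighted mean of eigenvalues, so some eigenvalue is at least [c];
    all eigenvalues being nonnegative, its power alone bounds the trace from below. *)
Lemma mxtrace_partial_gram_ge j n c y : eta * (M%:R * l) <= 1 -> 0 <= c ->
  dot y y = 1 -> c <= dot y (partial_gram j *m y) ->
  c ^+ n <= \tr (partial_gram j ^+ n).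
Proof.
move=> kappa1 c0 yy cy.
have [P [PP GE]] := spectrum_diag_conj (partial_gram_sym j).
set d := fun i : 'I_k => eigval (partial_gram j) i.+1.
have d0 (i : 'I_k) : 0 <= d i.
  apply: (diag_conj_ge PP GE) => x; rewrite mul0r.
  by apply: le_trans (dot_partial_gram_ge j x); rewrite mulr_ge0 ?dot_ge0 ?subr_ge0.
have [i ci] : exists i, c <= d i.
  apply/not_existsP => h; move: cy; rewrite leNgt => /negP; apply.
  rewrite (dot_diag_conj PP GE) -[ltRHS]mulr1 -yy (dot_orthomx PP GE).
  (* A coordinate of positive weight makes the comparison with [c] strict. *)
  have [i yi] : exists i, (P *m y) i 0 != 0.
    apply/not_existsP => h'; move: (oner_eq0 R).
    rewrite -yy (dot_orthomx PP GE) big1 ?eqxx// => i _.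
    by apply/eqP; rewrite sqrf_eq0; apply/negPn/negP => /h'.
  have dc m : d m < c by rewrite ltNge; apply/negP => /h.
  rewrite mulr_sumr (bigD1 i)//= [ltRHS](bigD1 i)//=; apply: ltr_leD.
    by rewrite ltr_pM2r ?dc// lt_neqAle sqr_ge0 eq_sym sqrf_eq0 yi.
  by apply: ler_sum => m _; apply: ler_wpM2r; [exact: sqr_ge0|exact: ltW (dc m)].
rewrite (mxtrace_diag_conj_expr PP GE) (bigD1 i)//= -[leLHS]addr0; apply: lerD.
  by rewrite lerXn2r// nnegrE; exact: d0.
by apply: sumr_ge0 => m _; apply: exprn_ge0; exact: d0.
Qed.

Lemma mxtrace_partial_gramS (j : 'I_M) n kappa : eta * (M%:R * l) <= kappa ->
  kappa < 1 ->
  \tr (partial_gram j.+1 ^+ n.+2) <= \tr (partial_gram j ^+ n.+2) -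
    n.+2%:R * eta * (1 - n.+2%:R * eta * l / (1 - kappa) ^+ 2) *
    dot (v j) (partial_gram j ^+ n.+2 *m v j).
Proof.
move=> hk k1.
have ge m x : (1 - kappa) * dot x x <= dot x (partial_gram m *m x).
  apply: le_trans (dot_partial_gram_ge m x).
  by rewrite ler_wpM2r ?dot_ge0// lerB.
have ge0 m x : 0 <= dot x (partial_gram m *m x).
  by apply: le_trans (ge m x); rewrite mulr_ge0 ?dot_ge0 ?subr_ge0 ?ltW.
apply: (mxtrace_expr_update_le (partial_gram_sym _) (partial_gram_sym _)) => //.
- exact: partial_gramS.
- exact: dot_partial_gram_le.
Qed.

End partial_gram.

Section chernoff.
Context d d' (Omega : measurableType d) (T : measurableType d') (R : realType).
Variables (P : probability Omega R) (M : nat) (X : 'I_M -> {RV P >-> T}).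
Hypothesis indX : mutually_independent X.
Variables (k : nat) (v : T -> 'cV[R]_k) (l mu : R) (s : 'rV[R]_k).
Hypothesis bv : forall a, bounded_mfun (fun x => v x a 0).
Hypothesis l0 : 0 < l.
Hypothesis mu0 : 0 <= mu.
Hypothesis vl : forall x, dot (v x) (v x) <= l.
Hypothesis smu : forall a, mu <= s 0 a.
Hypothesis Ev : forall i a b,
  \int[P]_w (v (X i w) a 0 * v (X i w) b 0) = diag_mx s a b.

Let G eta j w := partial_gram (fun i => v (X i w)) eta j.

(** The entries depend on the samples of index below [j] only, in the algebraic form that
    [past_independent] accepts. *)
Let past_G eta j a b : past X j (fun w => G eta j w a b).
Proof.
pose F (i : 'I_M) w := (if (i < j)%N then v (X i w) a 0 * v (X i w) b 0 else 0).
have pF : past X j (fun w => (a == b)%:R + (- eta) * \sum_(i < M) F i w).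
  apply: past_add; first exact: past_cst.
  apply: past_mul; first exact: past_cst.
  apply: past_sum => i; rewrite /F.
  have [ij|_] := boolP (i < j)%N; last exact: past_cst.
  exact: (past_var X ij (bounded_mfunM (bv a) (bv b))).
move: pF; congr past; apply/funext => w.
rewrite /G /partial_gram !mxE mulNr; congr (_ - _ * _).
rewrite summxE [RHS]big_mkcond /=; apply: eq_bigr => i _.
by rewrite /F; case: ifP => // _; rewrite mxE big_ord1 !mxE.
Qed.

Let past_GX eta j n a b : past X j (fun w => (G eta j w ^+ n) a b).
Proof.
elim: n a b => [|n IH] a b.
  have := past_cst X j (a == b)%:R.
  by congr past; apply/funext => w; rewrite expr0 mxE.
have : past X j (fun w => \sum_c G eta j w a c * (G eta j w ^+ n) c b).
  by apply: past_sum => c; apply: past_mul.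
by congr past; apply/funext => w; rewrite exprS mxE.
Qed.

Let int Z : bounded_mfun Z -> P.-integrable setT (EFin \o Z).
Proof. exact: bounded_mfun_integrable. Qed.

Let past_trace eta j n : past X j (fun w => \tr (G eta j w ^+ n)).
Proof. exact: past_sum. Qed.

Let GX_ge0 (eta : R) j n w x : 0 <= eta -> eta * (M%:R * l) <= 1 ->
  0 <= dot x (G eta j w ^+ n *m x).
Proof.
move=> eta0 etal; apply: quad_expr_ge0; first exact: partial_gram_sym.
move=> y; apply: le_trans (dot_partial_gram_ge eta0 (fun i => vl (X i w)) j y).
by rewrite mulr_ge0 ?dot_ge0 ?subr_ge0.
Qed.

Let mxE_quad (A : 'M[R]_k) x : dot x (A *m x) = \sum_a \sum_b A a b * (x a 0 * x b 0).
Proof.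
apply: eq_bigr => a _; rewrite mxE mulr_sumr; apply: eq_bigr => b _; ring.
Qed.

(** Independence replaces the outer product of the fresh vector by its mean [diag_mx s]. Only
    diagonal entries of the power survive; they are nonnegative in expectation and weighted by at
    least [mu]. *)
Let step (eta : R) (j : 'I_M) n : 0 <= eta -> eta * (M%:R * l) <= 1 ->
  mu * \int[P]_w \tr (G eta j w ^+ n) <=
  \int[P]_w dot (v (X j w)) (G eta j w ^+ n *m v (X j w)).
Proof.
move=> eta0 etal.
have bvv a b : bounded_mfun (fun x => v x a 0 * v x b 0) by exact: bounded_mfunM.
have bvX a b : bounded_mfun (fun w => v (X j w) a 0 * v (X j w) b 0).
  by apply: (bounded_mfun_comp (bvv a b)); exact: measurable_funP.
have -> : \int[P]_w dot (v (X j w)) (G eta j w ^+ n *m v (X j w)) =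
    \int[P]_w \sum_a \sum_b (G eta j w ^+ n) a b *
      (v (X j w) a 0 * v (X j w) b 0).
  by apply: eq_Rintegral => w _; exact: mxE_quad.
have bG a b := past_bounded (past_GX eta j n a b).
rewrite [leRHS]Rintegral_bigsum; last first.
  by move=> a; apply: bounded_mfun_sum => b; exact: bounded_mfunM.
rewrite Rintegral_bigsum; last by [].
rewrite mulr_sumr; apply: ler_sum => a _.
rewrite Rintegral_bigsum; last by move=> b /=; exact: bounded_mfunM.
rewrite (bigD1 a)//= big1 => [|b ba]; last first.
  rewrite (past_independent indX (past_GX eta j n a b) (bvv a b)) Ev mxE.
  by rewrite eq_sym (negPf ba) mulr0.
rewrite (past_independent indX (past_GX eta j n a a) (bvv a a)) Ev mxE eqxx.
rewrite addr0 mulrC mulr1n ler_wpM2l//; apply: Rintegral_ge0 => w _.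
by have := GX_ge0 j n w (delta_mx a 0) eta0 etal; rewrite dot_delta -colE mxE.
Qed.

(** Each step multiplies the expected trace by at most one minus a fixed amount, and
    [1 - x <= expR (- x)]; the start is the trace [k] of the identity. *)
Lemma Rintegral_mxtrace_partial_gram (eta : R) n (kappa : R) j :
  0 <= eta -> eta * (M%:R * l) <= kappa -> kappa < 1 ->
  0 <= 1 - n.+2%:R * eta * l / (1 - kappa) ^+ 2 -> (j <= M)%N ->
  \int[P]_w \tr (G eta j w ^+ n.+2) <= k%:R * expR (- (j%:R *
    (n.+2%:R * eta * mu * (1 - n.+2%:R * eta * l / (1 - kappa) ^+ 2)))).
Proof.
move=> eta0 etak k1; set c := 1 - _; move=> c0.
have etal := le_trans etak (ltW k1).
elim: j => [|j IH] jM.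
  rewrite mul0r oppr0 expR0 mulr1.
  under eq_Rintegral do rewrite /G partial_gram0 expr1n mxtrace1.
  by rewrite Rintegral_probability_cst.
have {}IH := IH (ltnW jM); pose i := Ordinal jM.
pose Phi m := \int[P]_w \tr (G eta m w ^+ n.+2).
have Phi0 m : 0 <= Phi m.
  apply: Rintegral_ge0 => w _; apply: sumr_ge0 => a _.
  by have := GX_ge0 m n.+2 w (delta_mx a 0) eta0 etal; rewrite dot_delta -colE mxE.
have bT m := past_bounded (past_trace eta m n.+2).
have bQ : bounded_mfun (fun w => dot (v (X i w)) (G eta i w ^+ n.+2 *m v (X i w))).
  under [Y in bounded_mfun Y]funext do rewrite mxE_quad.
  apply: bounded_mfun_sum => a; apply: bounded_mfun_sum => b.
  apply: bounded_mfunM; first exact: (past_bounded (past_GX eta i _ a b)).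
  apply: (bounded_mfun_comp (bounded_mfunM (bv a) (bv b))).
  exact: measurable_funP.
have h1 : Phi j.+1 <= Phi j - n.+2%:R * eta * c * (mu * Phi j).
  apply: (@le_trans _ _ (\int[P]_w (\tr (G eta i w ^+ n.+2) - n.+2%:R * eta * c *
      dot (v (X i w)) (G eta i w ^+ n.+2 *m v (X i w))))).
    apply: le_Rintegral => //.
    - exact: (int (bT j.+1)).
    - exact: int (bounded_mfunB (bT j) (bounded_mfunZ _ bQ)).
    - move=> w _.
      exact: (mxtrace_partial_gramS eta0 (fun i => vl (X i w)) i n etak k1).
  rewrite RintegralB//; last 2 first.
  - exact: (int (bT j)).
  - exact: int (bounded_mfunZ _ bQ).
  rewrite RintegralZl//; last exact: int.
  rewrite lerB// ler_wpM2l ?mulr_ge0//.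
  exact: (step i n.+2 eta0 etal).
apply: (le_trans h1).
have -> : Phi j - n.+2%:R * eta * c * (mu * Phi j) =
  (1 + - (n.+2%:R * eta * mu * c)) * Phi j by ring.
apply: (@le_trans _ _ (expR (- (n.+2%:R * eta * mu * c)) * Phi j)).
  by rewrite ler_wpM2r// expR_ge1Dx.
apply: le_trans (ler_wpM2l (expR_ge0 _) IH) _.
rewrite mulrCA -expRD; set q := n.+2%:R * _ * _ * _.
by rewrite (_ : - q - j%:R * q = - (j.+1%:R * q)) // -natr1; ring.
Qed.

(** Markov's inequality for the trace of the power [N = n + 2]: on [F] a unit vector has form at
    least [1 - x], so the trace is at least [(1 - x) ^+ N]. *)
Lemma probability_small_quad_le (theta t : R) n (kappa : R) (F : set Omega) :
  0 <= theta -> 0 <= t -> theta / n.+2%:R * (M%:R * l) <= kappa -> kappa < 1 ->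
  0 <= 1 - theta * l / (1 - kappa) ^+ 2 ->
  theta * M%:R * t / n.+2%:R < 1 ->
  measurable F ->
  (forall w, F w -> exists2 y, dot y y = 1 &
    dot y ((\sum_(i < M) v (X i w) *m (v (X i w))^T) *m y) <= M%:R * t) ->
  fine (P F) <= k%:R * expR (theta * M%:R * t / (1 - theta * M%:R * t / n.+2%:R)
    - M%:R * (theta * mu * (1 - theta * l / (1 - kappa) ^+ 2))).
Proof.
move=> theta0 t0 hk k1 c0 x1 mF HF.
pose eta := theta / n.+2%:R.
have eta0 : 0 <= eta by rewrite divr_ge0.
have etaN : n.+2%:R * eta = theta by rewrite mulrC divfK.
set q := theta * M%:R * t in x1 *; pose x := q / n.+2%:R.
have q0 : 0 <= q by rewrite !mulr_ge0.
have xs : 0 < 1 - x by rewrite subr_gt0.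
have := @Rintegral_mxtrace_partial_gram eta n kappa M eta0 hk k1.
rewrite etaN => /(_ c0 (leqnn _)) HT.
(* The inequality [1 + u <= expR u] is used at [u = x / (1 - x)], where [1 + u] is the inverse of
   [1 - x]; then [N * x = q]. *)
have hE : expR (- (q / (1 - x))) <= (1 - x) ^+ n.+2.
  have h : 1 + x / (1 - x) <= expR (x / (1 - x)) by exact: expR_ge1Dx.
  have e : 1 + x / (1 - x) = (1 - x)^-1.
    by field; rewrite gt_eqF.
  have : expR (- (x / (1 - x))) <= 1 - x.
    rewrite expRN -[leRHS]invrK lef_pV2 ?posrE ?expR_gt0 ?invr_gt0//.
    by rewrite -[leLHS]e.
  move=> /(lerXn2r n.+2 (expR_ge0 _) (ltW xs)).
  rewrite -expRM_natl mulrN; congr (expR (- _) <= _).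
  by rewrite /x mulrA mulrCA divff ?mulr1.
have bT := past_bounded (past_trace eta M n.+2).
have hP : fine (P F) * (1 - x) ^+ n.+2 <= \int[P]_w \tr (G eta M w ^+ n.+2).
  have -> : fine (P F) = \int[P]_w \1_F w.
    by rewrite /Rintegral integral_indic// setIT.
  rewrite mulrC -RintegralZl//; last exact: int (bounded_mfun_indic _ mF).
  apply: le_Rintegral => //.
  - exact: int (bounded_mfunZ _ (bounded_mfun_indic _ mF)).
  - exact: int.
  move=> w _; rewrite indicE; case: (boolP (w \in F)) => [/set_mem Fw|_].
    rewrite mulr1; have [y yy hy] := HF w Fw.
    have := @mxtrace_partial_gram_ge _ _ _ _ _ _ eta0 (fun i => vl (X i w)) M n.+2 _ _
      (le_trans hk (ltW k1)) (ltW xs) yy.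
    apply.
    rewrite dot_partial_gram yy lerB//.
    have -> : x = eta * (M%:R * t) by rewrite /x /q /eta; ring.
    rewrite ler_wpM2l//; apply: le_trans hy.
    rewrite mulmx_suml dot_sumr (eq_bigl predT) => [|i]; last exact: ltn_ord.
    by apply: ler_sum => i _; rewrite mulmx_outer dotZr (dotC y) -expr2.
  rewrite mulr0; apply: sumr_ge0 => a _.
  have := GX_ge0 M n.+2 w (delta_mx a 0) eta0 (le_trans hk (ltW k1)).
  by rewrite dot_delta -colE mxE.
have P0 : 0 <= fine (P F) by exact: fine_ge0.
have := ler_wpM2r (expR_ge0 (q / (1 - x)))
  (le_trans (ler_wpM2l P0 hE) (le_trans hP HT)).
rewrite -(mulrA (fine _)) -(mulrA k%:R) -!expRD addNr expR0 mulr1 => h.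
by apply: (le_trans h); rewrite addrC.
Qed.

(** The left side of the previous bound is free of [n], so the limit may be taken on the right: both
    [kappa] and [q / N] tend to zero. *)
Lemma probability_small_quad_exp (theta t : R) (F : set Omega) :
  0 <= theta -> 0 <= t -> theta * l < 1 -> measurable F ->
  (forall w, F w -> exists2 y, dot y y = 1 &
    dot y ((\sum_(i < M) v (X i w) *m (v (X i w))^T) *m y) <= M%:R * t) ->
  fine (P F) <= k%:R *
    expR (theta * M%:R * t - M%:R * (theta * mu * (1 - theta * l))).
Proof.
move=> theta0 t0 tl1 mF HF.
pose u (n : nat) : R := n.+2%:R^-1.
have u0 : u n @[n --> \oo] --> (0 : R).
  by have := @cvg_harmonic R; rewrite -cvg_shiftS.
have cu (a : R) : a * u n @[n --> \oo] --> (0 : R).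
  by rewrite -[X in _ --> X](mulr0 a); apply: cvgMr.
have c1 (a : R) : (1 - a * u n)^-1 @[n --> \oo] --> (1 : R).
  rewrite -[X in _ --> X]invr1; apply: cvgV; first exact: oner_neq0.
  by rewrite -[X in _ --> X]subr0; apply: cvgB => //; exact: cvg_cst.
pose kappa n := theta * (M%:R * l) * u n.
pose c n := 1 - theta * l * ((1 - kappa n)^-1 * (1 - kappa n)^-1).
have cc : c n @[n --> \oo] --> 1 - theta * l.
  have -> : 1 - theta * l = 1 - theta * l * (1 * 1) by rewrite !mulr1.
  apply: cvgB; first exact: cvg_cst.
  by apply: cvgMr; apply: cvgM; exact: c1.
pose q := theta * M%:R * t.
pose phi n := q * (1 - q * u n)^-1 - M%:R * (theta * mu * c n).
have cphi : k%:R * expR (phi n) @[n --> \oo] -->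
    k%:R * expR (q - M%:R * (theta * mu * (1 - theta * l))).
  apply: cvgMr; apply: continuous_cvg; first exact: continuous_expR.
  apply: cvgB; last by apply: cvgMr; exact: cvgMr.
  by rewrite -[X in _ --> X]mulr1; exact: cvgMr.
apply: (cvgr_to_ge cphi).
(* The side conditions of the finite bound hold for all large [n]; positivity of [c n] comes from
   its limit [1 - theta * l > 0]. *)
have e1 : \forall n \near \oo, kappa n < 1.
  by apply: (cvgr_lt 0) => //; exact: cu.
have e2 : \forall n \near \oo, 0 < c n.
  by apply: (cvgr_gt (1 - theta * l)) => //; rewrite subr_gt0.
have e3 : \forall n \near \oo, q * u n < 1.
  by apply: (cvgr_lt 0) => //; exact: cu.
near=> n.
have := @probability_small_quad_le theta t n (kappa n) F theta0 t0.
have -> : theta / n.+2%:R * (M%:R * l) = kappa n by rewrite /kappa /u; ring.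
have -> : theta * l / (1 - kappa n) ^+ 2 = 1 - c n.
  by rewrite /c expr2 invfM; ring.
rewrite opprB addrC subrK; apply => //.
- by near: n.
- by apply: ltW; near: n.
- by near: n.
Unshelve. all: by end_near. Qed.

End chernoff.

(** * Measurability of matrix-valued random variables *)

Section matrix_topology.
Variable R : realType.

Lemma continuous_mx (T : topologicalType) m n (F : T -> 'M[R]_(m, n)) :
  (forall i j, continuous (fun t => F t i j)) -> continuous F.
Proof.
move=> cF x; apply/cvg_ballP => e e0.
have H : \forall t \near x, forall i j, ball (F x i j) e (F t i j).
  apply: filter_forall => i; apply: filter_forall => j.
  by have /cvg_ballP := cF i j x; apply.
by near=> t; split => //; near: t.
Unshelve. all: by end_near. Qed.

Lemma continuous_bigsum (T : topologicalType) (I : Type) (r : seq I)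
    (F : I -> T -> R) :
  (forall i, continuous (F i)) -> continuous (fun t => \sum_(i <- r) F i t).
Proof.
move=> cF; elim: r => [|i r IH] x.
  under [X in continuous_at _ X]funext do rewrite big_nil.
  exact: cvg_cst.
under [X in continuous_at _ X]funext do rewrite big_cons.
by apply: continuousD; [exact: cF|exact: IH].
Qed.

Lemma open_lt_continuous (T : topologicalType) (h : T -> R) y :
  continuous h -> open [set t | h t < y].
Proof.
move=> ch; rewrite (_ : [set t | h t < y] = h @^-1` `]-oo, y[%classic).
  by apply: open_comp; [move=> t _; exact: ch|exact: interval_open].
by apply/seteqP; split => t /=; rewrite in_itv.
Qed.

Lemma open_rat_box m n (O : set 'M[R]_(m, n)) (x : 'M[R]_(m, n)) :
  open O -> O x -> exists q : 'M[rat]_(m, n) * 'M[rat]_(m, n),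
    (forall i j, ratr (q.1 i j) < x i j < ratr (q.2 i j)) /\
    [set y : 'M[R]_(m, n) | forall i j,
      ratr (q.1 i j) < y i j < ratr (q.2 i j)] `<=` O.
Proof.
move=> oO Ox; have /nbhs_ballP[e /= e0 eO] := open_nbhs_nbhs (conj oO Ox).
have H (ij : 'I_m * 'I_n) : exists pq : rat * rat,
    [/\ x ij.1 ij.2 - e < ratr pq.1, ratr pq.1 < x ij.1 ij.2,
        x ij.1 ij.2 < ratr pq.2 & ratr pq.2 < x ij.1 ij.2 + e].
  have /rat_in_itvoo[p /itvP pP] : x ij.1 ij.2 - e < x ij.1 ij.2.
    by rewrite ltrBlDr ltrDl.
  have /rat_in_itvoo[q /itvP qP] : x ij.1 ij.2 < x ij.1 ij.2 + e.
    by rewrite ltrDl.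
  by exists (p, q); split => /=; rewrite ?pP ?qP.
have [g gP] := choice H.
exists (\matrix_(i, j) (g (i, j)).1, \matrix_(i, j) (g (i, j)).2).
split => [i j|y /= yP]; first by have [_ h1 h2 _] := gP (i, j); rewrite !mxE h1 h2.
apply: eO; split => // i j.
have [/= h1 _ _ h4] := gP (i, j); have := yP i j; rewrite !mxE => /andP[h2 h3].
rewrite -ball_normE /= ltr_distlC.
by rewrite (lt_trans h1 h2) (lt_trans h3 h4).
Qed.

Lemma open_rat_mx m n (O : set 'M[R]_(m, n)) (x : 'M[R]_(m, n)) :
  open O -> O x -> exists q : 'M[rat]_(m, n), O (map_mx ratr q).
Proof.
move=> oO Ox; have [q [qx qO]] := open_rat_box oO Ox.
have H (ij : 'I_m * 'I_n) : exists r : rat,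
    (ratr (q.1 ij.1 ij.2) : R) < (ratr r : R) < (ratr (q.2 ij.1 ij.2) : R).
  have /andP[h1 h2] := qx ij.1 ij.2.
  have /rat_in_itvoo[r rP] := lt_trans h1 h2.
  by exists r; move: rP; rewrite in_itv /=; apply.
have [g gP] := choice H.
exists (\matrix_(i, j) g (i, j)); apply: qO => i j.
by rewrite !mxE; exact: gP (i, j).
Qed.

(** An open set is a countable union of boxes with rational corners, and a box is a finite
    intersection of conditions on single entries. *)
Lemma measurable_preimage_mx d (T : measurableType d) m n
    (G : T -> 'M[R]_(m, n)) (O : set 'M[R]_(m, n)) :
  (forall i j, measurable_fun setT (fun t => G t i j)) -> open O ->
  measurable (G @^-1` O).
Proof.
move=> mG oO.
pose box (q : 'M[rat]_(m, n) * 'M[rat]_(m, n)) := [set y : 'M[R]_(m, n) |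
  forall i j, ratr (q.1 i j) < y i j < ratr (q.2 i j)].
have -> : O = \bigcup_(q in [set q | box q `<=` O]) box q.
  apply/seteqP; split => [x Ox|x [q /= qO]]; last exact: qO.
  by have [q [qx qO]] := open_rat_box oO Ox; exists q.
rewrite preimage_bigcup bigcup_mkcond.
apply: countable_bigcupT_measurable => [|q]; first exact: countableP.
case: ifP => _; last exact: measurable0.
rewrite [X in measurable X](_ : _ = \bigcap_(i in [set: 'I_m])
    \bigcap_(j in [set: 'I_n]) ((fun t => G t i j) @^-1`
      `]ratr (q.1 i j), ratr (q.2 i j)[%classic)); last first.
  apply/seteqP; split => [t h i _ j _|t h i j] /=.
    by rewrite in_itv; exact: h.
  by have := h i Logic.I j Logic.I; rewrite /= in_itv.
apply: fin_bigcap_measurable => // i _; apply: fin_bigcap_measurable => // j _.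
by rewrite -[X in measurable X]setTI; apply: mG => //; exact: measurable_itv.
Qed.

Lemma measurable_continuous_borelRn n (h : 'cV[R]_n -> R) : continuous h ->
  measurable_fun setT (h : borelRn R n -> R).
Proof.
move=> ch; 
apply: (@measurability _ _ (borelRn R n) (measurableTypeR R) setT h _
  (@RGenOpens.measurableE R)).
move=> _ [_ [a [b ->]] <-]; rewrite setTI.
by apply: sub_sigma_algebra; apply: open_comp => //; exact: interval_open.
Qed.

(** Weyl's inequality with a crude bound: a unit vector has coordinates at most one in absolute
    value, so each of the [n * n] terms of the form is at most [e]. *)
Lemma eigval_lipschitz n k (A B : 'M[R]_n) e : A^T = A -> B^T = B ->
  (k < n)%N -> (forall i j, `|A i j - B i j| <= e) ->
  eigval A k.+1 <= eigval B k.+1 + e * (n%:R * n%:R).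
Proof.
move=> symA symB kn AB; apply: eigval_Weyl => // x x1.
have xi i : `|x i 0| <= 1.
  rewrite -ler_sqr ?nnegrE// expr1n real_normK ?num_real// -x1 /dot (bigD1 i)//= -expr2 lerDl.
  by apply: sumr_ge0 => j _; rewrite -expr2 sqr_ge0.
apply: (le_trans (ler_norm _)); apply: (le_trans (ler_norm_sum _ _ _)).
apply: (@le_trans _ _ (\sum_(i < n) (n%:R * e))); last first.
  by rewrite sumr_const card_ord -(mulr_natl (_ * e)) mulrA mulrC.
apply: ler_sum => i _; rewrite normrM -[leRHS]mul1r; apply: ler_pM => //.
rewrite mxE; apply: (le_trans (ler_norm_sum _ _ _)).
apply: (@le_trans _ _ (\sum_(i < n) e)); last first.
  by rewrite sumr_const card_ord -(mulr_natl e).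
apply: ler_sum => j _; rewrite normrM -[leRHS]mulr1; apply: ler_pM => //.
by rewrite !mxE.
Qed.

Let sym n (A : 'M[R]_n) := 2^-1 *: (A + A^T).

Let sym_tr n (A : 'M[R]_n) : (sym A)^T = sym A.
Proof. by rewrite /sym linearZ linearD /= trmxK addrC. Qed.

Let sym_id n (A : 'M[R]_n) : A^T = A -> sym A = A.
Proof.
by move=> symA; apply/matrixP => i j; rewrite /sym symA !mxE; field.
Qed.

(* [eigval] is junk on matrices whose characteristic polynomial does not split,
   hence the symmetrization. *)
Lemma open_eigval_gt n k t : (k < n)%N ->
  open [set A : 'M[R]_n | t < eigval (sym A) k.+1].
Proof.
move=> kn; rewrite openE => A /= tA; apply/nbhs_ballP.
(* The extra [1] in the denominator keeps the possible loss [e * (n * n)] strictly below the gap. *)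
pose e := (eigval (sym A) k.+1 - t) / (n%:R * n%:R + 1).
have N0 : 0 < n%:R * n%:R + 1 :> R by rewrite ltr_wpDl// mulr_ge0.
have e0 : 0 < e by rewrite divr_gt0 // subr_gt0.
exists e => //= B [_ AB] /=.
have h : eigval (sym A) k.+1 <= eigval (sym B) k.+1 + e * (n%:R * n%:R).
  apply: eigval_lipschitz => // i j.
  have := AB i j; have := AB j i; rewrite -!ball_normE /= !mxE.
  set a := A i j; set a' := A j i; set b := B i j; set b' := B j i.
  rewrite !ltr_norml ler_norml => /andP[h1 h2] /andP[h3 h4].
  by apply/andP; split; lra.
suff : e * (n%:R * n%:R) < eigval (sym A) k.+1 - t by move: h; lra.
rewrite -[ltRHS](@divfK _ (n%:R * n%:R + 1)) ?gt_eqF// -/e.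
by rewrite ltr_pM2l// ltrDl.
Qed.

Lemma measurable_eigval_gt d (T : measurableType d) n k t (G : T -> 'M[R]_n) :
  (forall i j, measurable_fun setT (fun w => G w i j)) ->
  (forall w, (G w)^T = G w) -> (k < n)%N ->
  measurable [set w | t < eigval (G w) k.+1].
Proof.
move=> mG symG kn.
have := measurable_preimage_mx mG (open_eigval_gt (t := t) kn).
by congr measurable; apply/seteqP; split => w /=; rewrite sym_id.
Qed.

(** The event is a union over uncountably many [z]; measurability is needed to compare its
    probability with that of an eigenvalue event. *)
Lemma measurable_exists_min d (T : measurableType d) n m
    (f : 'cV[R]_n -> R) (a : R) (p : 'cV[R]_n) (G : T -> 'M[R]_(n, m)) :
  continuous f -> (forall x, a <= f x) ->
  (forall i j, measurable_fun setT (fun w => G w i j)) ->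
  measurable [set w | exists z : 'cV[R]_m, f (G w *m z + p) = a].
Proof.
move=> cf af mG.
have cz (A : 'M[R]_(n, m)) : continuous (fun z : 'rV[R]_m => f (A *m z^T + p)).
  move=> z; apply: continuous_comp; last exact: cf.
  move: z; apply: continuous_mx => i j z /=.
  under [X in continuous_at _ X]funext do rewrite !mxE.
  apply: continuousD; last exact: cst_continuous.
  apply: continuous_bigsum => l {}z; apply: continuousM; first exact: cst_continuous.
  rewrite (_ : (fun x : 'rV[R]_m => x^T l j) = (fun x => x j l)).
    exact: coord_continuous.
  by apply/funext => x; rewrite mxE.
have cA (z : 'cV[R]_m) : continuous (fun A : 'M[R]_(n, m) => f (A *m z + p)).
  move=> A; apply: continuous_comp; last exact: cf.
  move: A; apply: continuous_mx => i j A /=.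
  under [X in continuous_at _ X]funext do rewrite !mxE.
  apply: continuousD; last exact: cst_continuous.
  apply: continuous_bigsum => l {}A; apply: continuousM; last exact: cst_continuous.
  exact: coord_continuous.
(* A minimizer exists within radius [K] iff rational points of that ball come
   arbitrarily close to the value [a], by compactness. *)
pose S (K N : nat) := \bigcup_(q in [set: 'rV[rat]_m])
  [set w | \sum_i `|ratr (q 0 i) : R| < K%:R /\
     f (G w *m (map_mx ratr q)^T + p) < a + N.+1%:R^-1].
have mS K N : measurable (S K N).
  apply: countable_bigcupT_measurable => [|q]; first exact: countableP.
  have [h|h] := pselect (\sum_i `|ratr (q 0 i) : R| < K%:R); last first.
    rewrite [X in measurable X](_ : _ = set0); first exact: measurable0.
    by apply/seteqP; split => w // -[].
  have oU : open [set A : 'M[R]_(n, m) |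
      f (A *m (map_mx ratr q)^T + p) < a + N.+1%:R^-1].
    exact/open_lt_continuous/cA.
  have := measurable_preimage_mx mG oU.
  by congr measurable; apply/seteqP; split => [w|w []].
rewrite [X in measurable X](_ : _ = \bigcup_K \bigcap_N S K N); last first.
  apply/seteqP; split => [w [z zP]|w [K _ SK]] /=.
    pose K := (Num.trunc (\sum_i `|z i 0|)).+1.
    exists K => // N _.
    pose O := [set y : 'rV[R]_m | \sum_i `|y 0 i| < K%:R] `&`
      [set y | f (G w *m y^T + p) < a + N.+1%:R^-1].
    have oO : open O.
      apply: openI; apply: open_lt_continuous => //.
      apply: continuous_bigsum => i y.
      apply: continuous_comp; first exact: coord_continuous.
      exact: norm_continuous.
    have [q [q1 q2]] : exists q : 'rV[rat]_m, O (map_mx ratr q).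
      apply: (@open_rat_mx _ _ _ z^T) => //; split => /=.
        under eq_bigr do rewrite mxE.
        exact: truncnS_gt.
      by rewrite trmxK zP ltrDl invr_gt0.
    exists q => //; split => //; move: q1 => /=.
    by under eq_bigr do rewrite mxE.
  (* The sum-norm ball lies in this compact cube. The minimum over the cube is therefore at most
     [a + 1 / (N + 1)] for every [N], hence equal to [a]. *)
  pose B := [set y : 'rV[R]_m | forall i, `[- K%:R, K%:R]%classic (y 0 i)].
  have cB : compact B 
    by exact: (@rV_compact R m _ (fun=> @segment_compact R (- K%:R) K%:R)).
  have B0 : B !=set0.
    by exists 0 => i; rewrite mxE /= in_itv /= oppr_le0 ler0n.
  have [|c cBc cmin] := compact_EVT_min B0 cB (f := fun y => f (G w *m y^T + p)).
    by apply: continuous_subspaceT; exact: cz.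
  exists c^T; apply/eqP; rewrite eq_le af andbT; apply/ler_addgt0Pr => e e0.
  have [N _ Ne] : exists2 N : nat, True & N.+1%:R^-1 < e.
    exists (Num.trunc e^-1) => //.
    by rewrite invf_plt ?posrE//; exact: truncnS_gt.
  have [q _ [q1 q2]] := SK N Logic.I.
  apply: (le_trans (cmin (map_mx ratr q) _)); last first.
    by apply/ltW/(lt_trans q2); rewrite ltrD2l.
  apply/mem_set => i; rewrite mxE /= in_itv /= -ler_norml.
  apply: (le_trans _ (ltW q1)); rewrite (bigD1 i)//= lerDl.
  exact: sumr_ge0.
apply: bigcup_measurable => K _; exact: bigcapT_measurable.
Qed.

End matrix_topology.

(** * Effective subspace and gradients *)

Section gradient.
Variables (R : realType) (n : nat) (f : 'cV[R]_n -> R).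
Hypothesis df : forall x, differentiable f x.

Lemma derive_dot_gradient x v : 'D_v f x = dot (gradient f x) v.
Proof.
rewrite deriveE// [in LHS](matrix_sum_delta v) linear_sum /dot.
apply: eq_bigr => i _; rewrite big_ord1 linearZ mxE deriveE//=.
exact: mulrC.
Qed.

Lemma dot_gradient_eq0 x y : (forall t, f (x + t *: y) = f x) ->
  dot (gradient f x) y = 0.
Proof.
move=> fxy; rewrite -derive_dot_gradient /derive.
rewrite (_ : (fun h => _) = fun=> 0); first exact: lim_cst.
by apply/funext => h; rewrite /= [h *: y + x]addrC fxy subrr scaler0.
Qed.

(** Along the line through [x] in direction [y] the derivative of [f] is identically zero, so [f] is
    constant there. *)
Lemma gradient_orth_invariant y : (forall x, dot (gradient f x) y = 0) ->
  forall x, f (x + y) = f x.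
Proof.
move=> gy x; pose h (t : R) := f (x + t *: y).
suff : h 1 = h 0 by rewrite /h scale1r scale0r addr0.
apply: is_derive_0_is_cst => t.
have E : (fun s : R => s^-1 *: ((h \o shift t) (s *: 1) - h t)) =
    (fun s => s^-1 *: ((f \o shift (x + t *: y)) (s *: y) - f (x + t *: y))).
  apply/funext => s; rewrite /h /=; congr (_ *: (f _ - _)).
  by rewrite -[s *: 1]/(s * 1) mulr1 scalerDl addrCA.
apply: DeriveDef.
  by rewrite /derivable E; exact: diff_derivable.
by rewrite /derive E -[LHS]/('D_y f (x + t *: y)) derive_dot_gradient.
Qed.

(** Normal equations: with a basis of [T] as the columns of [B], the projection is
    [B (B^T B)^-1 B^T x]. Freeness of the basis makes the Gram matrix invertible. *)
Lemma orth_decomposition (T : {vspace 'cV[R]_n}) x :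
  exists2 t, t \in T & forall u, u \in T -> dot u (x - t) = 0.
Proof.
pose b := vbasis T.
pose B : 'M[R]_(n, \dim T) := \matrix_(i, j) tnth b j i 0.
have BE c : B *m c = \sum_j c j 0 *: tnth b j.
  apply/colP => i; rewrite mxE summxE; apply: eq_bigr => j _.
  by rewrite !mxE mulrC.
have BT c : B *m c \in T.
  rewrite BE; apply: memv_suml => j _; apply: memvZ.
  by apply: (basis_mem (vbasisP T)); exact: mem_tnth.
have TB u : u \in T -> exists c, u = B *m c.
  move=> /coord_vbasis uE; exists (\col_j coord b j u).
  by rewrite {1}uE BE; apply: eq_bigr => j _; rewrite mxE (tnth_nth 0).
have KU : B^T *m B \in unitmx.
  rewrite -row_free_unit -kermx_eq0; apply/negPn/negP => /rowV0Pn[v].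
  move=> /sub_kermxP vK; apply/negP; rewrite negbK.
  have : B *m v^T == 0.
    by rewrite -dot_eq0 dot_mulmx dotC dotE trmxK (mulmxA B^T) mulmxA vK mul0mx mxE.
  rewrite BE => /eqP Bv0; apply/eqP/rowP => j.
  have /freeP/(_ (fun j => v 0 j)) := basis_free (vbasisP T).
  rewrite mxE; apply; rewrite -[RHS]Bv0; apply: eq_bigr => i _.
  by rewrite mxE (tnth_nth 0).
exists (B *m (invmx (B^T *m B) *m (B^T *m x))) => // u /TB[c ->].
rewrite dotC dot_mulmx mulmxBr mulmxA (mulmxA (B^T *m B)) mulmxV// mul1mx.
by rewrite subrr dotC dot0r.
Qed.

Variable T : {vspace 'cV[R]_n}.
Hypothesis fT : determined_on f T.

Lemma determined_on_translate x y : (forall t, t \in T -> dot t y = 0) ->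
  f (x + y) = f x.
Proof.
move=> Ty; have [t tT xt] := orth_decomposition T x.
have -> : x + y = t + ((x - t) + y) by rewrite addrA [t + _]addrC subrK.
rewrite fT//; first by rewrite -[in RHS](subrK t x) addrC fT.
by move=> u uT; rewrite dotDr Ty// xt// addr0.
Qed.

(** The component of the gradient orthogonal to [T] is a direction along which [f] is constant, so
    its inner product with the gradient, which is its own squared norm, vanishes. *)
Lemma gradient_mem x : gradient f x \in T.
Proof.
have [t tT gt] := orth_decomposition T (gradient f x).
suff : gradient f x - t == 0 by rewrite subr_eq0 => /eqP ->.
rewrite -dot_eq0; apply/eqP; rewrite [LHS]dotBl (gt t tT) subr0.
apply: dot_gradient_eq0 => s; apply: determined_on_translate => u uT.
by rewrite dotZr gt// mulr0.
Qed.

End gradient.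

(** * The numerical threshold on the sample size *)

Lemma exp_threshold (R : realType) (k alpha tau L M lam1 lam : R) :
  1 <= k -> 0 < alpha <= 1 -> 0 <= tau < 1 -> 0 < L -> 0 < lam <= lam1 ->
  4 * lam1 * L ^+ 2 / (lam ^+ 2 * (1 - tau) ^+ 2) * ln (k / alpha) <= M ->
  k * expR ((1 - tau) / (2 * L ^+ 2) * M * (tau * lam) -
    M * ((1 - tau) / (2 * L ^+ 2) * lam *
      (1 - (1 - tau) / (2 * L ^+ 2) * L ^+ 2))) <= alpha.
Proof.
move=> k1 /andP[a0 a1] /andP[t0 t1] L0 /andP[l0 ll] hM.
have k0 : 0 < k by apply: lt_le_trans k1.
have lnk : 0 <= ln (k / alpha).
  by rewrite ln_ge0// ler_pdivlMr// mul1r (le_trans a1).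
have s0 : 0 < 1 - tau by rewrite subr_gt0.
(* For [theta = (1 - tau) / (2 * L ^+ 2)] the bracket equals [(1 + tau) / 2], and
   [tau - (1 + tau) / 2 = - (1 - tau) / 2]. *)
rewrite [X in expR X](_ : _ = - (M * (lam * (1 - tau) ^+ 2 / (4 * L ^+ 2))));
  last by field; rewrite gt_eqF.
have h : ln (k / alpha) <= M * (lam * (1 - tau) ^+ 2 / (4 * L ^+ 2)).
  have q0 : 0 < lam * (1 - tau) ^+ 2 / (4 * L ^+ 2).
    by rewrite divr_gt0// mulr_gt0// exprn_gt0.
  apply: le_trans (ler_wpM2r (ltW q0) hM).
  (* Multiplied out, the threshold contributes [lam1 / lam] times the logarithm, and this ratio is
     at least one. *)
  rewrite [leRHS](_ : _ = lam1 / lam * ln (k / alpha)).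
    by rewrite ler_peMl// ler_pdivlMr// mul1r.
  by field; rewrite !gt_eqF.
rewrite expRN ler_pdivrMr ?expR_gt0// mulrC -ler_pdivrMr//.
apply: le_trans (_ : expR (ln (k / alpha)) <= _); last by rewrite ler_expR.
by rewrite lnK// posrE divr_gt0.
Qed.

Lemma range_basis_exists (R : realType) n d (A : 'M[R]_n) (U : 'M[R]_(n, d)) :
  is_range_basis A U -> forall x : 'cV[R]_n,
  (exists y, U *m y = x) <-> (exists z, A *m z = x).
Proof.
move=> [_ /andP[/submxP[Q UQ] /submxP[Q' AQ]]] x.
have UE : U = A *m Q^T by rewrite -[LHS]trmxK UQ trmx_mul trmxK.
have AE : A = U *m Q'^T by rewrite -[LHS]trmxK AQ trmx_mul trmxK.
by split=> -[y <-]; [exists (Q^T *m y)|exists (Q'^T *m y)];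
   rewrite mulmxA -?UE -?AE.
Qed.

(** * The gradient covariance and its sample version *)

Section active_subspace.
Variables (R : realType) (D : nat) (f : 'cV[R]_D -> R) (de : nat).
Variables (fstar L : R) (rho : borelRn R D -> R).
Context d (Omega : measurableType d) (P : probability Omega R).
Variables (M : nat) (X : 'I_M -> {RV P >-> borelRn R D}).
Hypothesis fC1 : continuously_differentiable f.
Hypothesis fde : effective_dim f de.
Hypothesis fmin : is_global_min f fstar.
Hypothesis L0 : 0 < L.
Hypothesis gL : forall x, enorm (gradient f x) <= L.
Hypothesis rho_pd : prob_density rho.
Hypothesis rho_full : full_support rho.
Hypothesis M0 : (0 < M)%N.
Hypothesis indX : mutually_independent X.
Hypothesis Xrho : forall j, has_density (X j) rho.

Let g := gradient f.
Let C := grad_covariance f rho.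
Let Chat w := sample_covariance f (fun j => X j w).
Let df := fC1.1.

Let cg u : continuous (fun x => dot u (g x)).
Proof.
apply: continuous_bigsum => i x; apply: continuousM; first exact: cst_continuous.
apply: (@continuous_comp _ _ _ g (fun y : 'cV[R]_D => y i 0)).
  exact: fC1.2.
exact: coord_continuous.
Qed.

Let gg_le x : dot (g x) (g x) <= L ^+ 2.
Proof.
have gE : enorm (g x) ^+ 2 = dot (g x) (g x).
  by rewrite /enorm sqr_sqrtr// dot_ge0.
by rewrite -gE; apply: lerXn2r (gL x); rewrite nnegrE ?sqrtr_ge0// ltW.
Qed.

Let bg u : bounded_mfun (fun x : borelRn R D => dot u (g x)).
Proof.
split.
  by apply: (@measurable_continuous_borelRn R D (fun x => dot u (g x))); exact: cg.
exists (Num.sqrt (dot u u * L ^+ 2)) => x.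
rewrite -sqrtr_sqr ler_wsqrtr//; apply: (le_trans (dot_CauchySchwarz _ _)).
by rewrite ler_wpM2l ?dot_ge0.
Qed.

Let mX i : measurable_fun setT (X i). Proof. exact: measurable_funP. Qed.

Let bgX u i : bounded_mfun (fun w => dot u (g (X i w))).
Proof. exact: (bounded_mfun_comp (bg u) (mX i)). Qed.

Let second_moment i u v :
  \int[P]_w (dot u (g (X i w)) * dot v (g (X i w))) = dot u (C *m v).
Proof.
pose F a b w := u a 0 * v b 0 * (g (X i w) a 0 * g (X i w) b 0).
have bc a : bounded_mfun (fun x : borelRn R D => g x a 0).
  have := bg (delta_mx a 0); congr bounded_mfun; apply/funext => x.
  exact: dot_delta.
have bcX a : bounded_mfun (fun w => g (X i w) a 0).
  exact: (bounded_mfun_comp (bc a) (mX i)).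
have bF a b : bounded_mfun (F a b).
  by apply: bounded_mfunZ; exact: bounded_mfunM.
transitivity (\int[P]_w \sum_a \sum_b F a b w).
  apply: eq_Rintegral => w _; rewrite mulr_suml; apply: eq_bigr => a _.
  by rewrite mulr_sumr; apply: eq_bigr => b _; rewrite /F; ring.
rewrite Rintegral_bigsum => [|a]; last exact: bounded_mfun_sum.
apply: eq_bigr => a _; rewrite Rintegral_bigsum// mxE mulr_sumr.
apply: eq_bigr => b _; rewrite /F RintegralZl//; last first.
  by apply: bounded_mfun_integrable; exact: bounded_mfunM.
have -> : \int[P]_w (g (X i w) a 0 * g (X i w) b 0) = C a b.
  have -> := Rintegral_density rho_pd (Xrho i) (bounded_mfunM (bc a) (bc b)).
  rewrite [RHS]mxE; apply: eq_Rintegral => x _.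
  by rewrite /grad_outer [in RHS]mxE big_ord1 [_^T _ _]mxE.
by rewrite mulrAC -mulrA.
Qed.

Let symC : C^T = C.
Proof.
apply/matrixP => a b; rewrite !mxE; apply: eq_Rintegral => x _.
by rewrite /grad_outer !mxE !big_ord1 !mxE; congr (_ * _); exact: mulrC.
Qed.

Let dot_Chat w u v : dot u (Chat w *m v) =
  M%:R^-1 * \sum_i dot u (g (X i w)) * dot v (g (X i w)).
Proof.
rewrite /Chat /sample_covariance -scalemxAl dotZr mulmx_suml dot_sumr.
congr (_ * _); apply: eq_bigr => i _.
by rewrite mulmx_outer dotZr mulrC (dotC v).
Qed.

Let symChat w : (Chat w)^T = Chat w.
Proof.
rewrite /Chat /sample_covariance linearZ linear_sum /=; congr (_ *: _).
by apply: eq_bigr => i _; rewrite trmx_mul trmxK.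
Qed.

Let mChat a b : measurable_fun setT (fun w => Chat w a b).
Proof.
have : bounded_mfun (fun w => M%:R^-1 * \sum_i
    dot (delta_mx a 0) (g (X i w)) * dot (delta_mx b 0) (g (X i w))).
  by apply/bounded_mfunZ/bounded_mfun_sum => i; exact: bounded_mfunM.
case=> + _; congr measurable_fun; apply/funext => w.
by rewrite -dot_Chat dot_delta -colE mxE.
Qed.

Let deD : (de <= D)%N.
Proof.
by have [[T <- _] _] := fde; rewrite (leq_trans (dimvS (subvf T)))// dimvf /=
  /dim /= muln1.
Qed.

(** If the gradient at [x0] were not orthogonal to [y], continuity would keep their inner product
    away from zero on an open set. Full support gives this set positive mass, so that the form of
    [C] would be positive. *)
Let dot_C_le0 y : dot y (C *m y) <= 0 -> forall x, dot (g x) y = 0.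
Proof.
move=> yC x0; apply/eqP/negPn/negP => gy.
have i : 'I_M := Ordinal M0.
(* Scaling by [- a] makes the inner product at [x0] equal to [- a ^+ 2], whatever the sign of [a],
   so a one-sided condition defines the open set; [c] is half of that size. *)
pose a := dot y (g x0); pose z := (- a) *: y.
have a0 : 0 < a ^+ 2 by rewrite lt_neqAle sqr_ge0 eq_sym sqrf_eq0 /a dotC gy.
pose c := a ^+ 2 / 2.
have c0 : 0 < c by rewrite divr_gt0.
have zC : dot z (C *m z) <= 0.
  rewrite /z -scalemxAr dotZl dotZr mulrA mulrNN -expr2.
  by rewrite mulr_ge0_le0// ltW.
pose U : set (borelRn R D) := [set x | dot z (g x) < - c].
have oU : open (U : set 'cV[R]_D) by exact/open_lt_continuous/cg.
have mU : measurable U by apply: sub_sigma_algebra.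
have mXU : measurable (X i @^-1` U) by rewrite -[S in measurable S]setTI; exact: mX.
have PU : 0 < fine (P (X i @^-1` U)).
  apply: fine_gt0; rewrite ltey_eq fin_num_measure// andbT.
  have := rho_full oU; rewrite -[X in (_ < X)%E](Xrho i mU); apply.
  exists x0; rewrite /U /= /z dotZl -/a mulNr -expr2 ltrN2 /c.
  by rewrite ltr_pdivrMr// ltr_pMr// ltr1n.
have : c ^+ 2 * fine (P (X i @^-1` U)) <= dot z (C *m z).
  rewrite -(second_moment i).
  have -> : fine (P (X i @^-1` U)) = \int[P]_w \1_(X i @^-1` U) w.
    by rewrite /Rintegral integral_indic// setIT.
  have bI := @bounded_mfun_indic _ _ R _ mXU.
  rewrite -RintegralZl//; last exact: bounded_mfun_integrable.
  apply: le_Rintegral => //.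
  - exact: bounded_mfun_integrable (bounded_mfunZ _ bI).
  - exact: bounded_mfun_integrable (bounded_mfunM (bgX z i) (bgX z i)).
  move=> w _; rewrite indicE -expr2; case: (boolP (w \in _)) => [/set_mem h|_].
    rewrite mulr1 -[leRHS]sqrrN; apply: lerXn2r; rewrite ?nnegrE ?ltW//.
      by rewrite oppr_gt0 (lt_trans h)// oppr_lt0.
    by rewrite ltrNr.
  by rewrite mulr0 sqr_ge0.
by rewrite leNgt (le_lt_trans zC)// mulr_gt0// exprn_gt0.
Qed.

(** Otherwise the form of [C] is nonpositive on the orthogonal complement of the [k] leading
    eigenvectors, gradients vanish in these directions, and [f] is determined on a subspace of
    dimension at most [k < de]. *)
Lemma eigval_grad_covariance_gt0 k : (k < de)%N -> 0 < eigval C k.+1.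
Proof.
move=> kde; rewrite ltNge; apply/negP => ek.
have kD := leq_trans kde deD.
have [Q [QQ CE]] := spectrum_diag_conj symC.
pose w (i : 'I_k) : 'I_D := widen_ord (ltnW kD) i.
pose s := [tuple (row (w i) Q)^T | i < k].
have : determined_on f (span s).
  move=> x y _ sy; apply: gradient_orth_invariant => // z.
  apply: dot_C_le0; rewrite (dot_diag_conj QQ CE); apply: sumr_le0 => i _.
  have [ik|ki] := ltnP i k.
    have -> : (Q *m y) i 0 = dot (row i Q)^T y.
      by rewrite dotE trmxK -row_mul [RHS]mxE.
    have -> : i = w (Ordinal ik) by apply: val_inj.
    rewrite sy ?expr0n ?mulr0//; apply: memv_span; apply/mapP.
    by exists (Ordinal ik); rewrite ?mem_enum.
  apply: mulr_le0_ge0; last exact: sqr_ge0.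
  by apply: le_trans ek; apply: eigval_le => //; rewrite ki /=.
move=> /(fde.2 _); rewrite leqNgt; apply/negP; rewrite negbK.
by rewrite (leq_ltn_trans (dim_span _))// size_tuple.
Qed.

(** The Chernoff bound is applied to the coordinates [v = W^T g] in the [k + 1] leading eigenvectors
    of [C], with [l = L ^+ 2], [mu = lam] and [t = tau * lam], on the complement of the event. *)
Lemma eigval_sample_covariance_lower (alpha tau : R) k :
  0 < alpha <= 1 -> 0 <= tau < 1 -> (k < de)%N ->
  4 * eigval C 1 * L ^+ 2 / (eigval C k.+1 ^+ 2 * (1 - tau) ^+ 2)
    * ln (k.+1%:R / alpha) <= M%:R ->
  ((1 - alpha)%:E <= P [set w | (tau * eigval C k.+1 < eigval (Chat w) k.+1)%R])%E.
Proof.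
move=> ha ht kde hM; have kD := leq_trans kde deD.
have lam0 := eigval_grad_covariance_gt0 kde.
set lam := eigval C k.+1 in hM lam0 *.
have [W [WW CW]] := eigval_top_frame symC kD.
pose v (x : borelRn R D) := W^T *m g x.
have vE x a : v x a 0 = dot (col a W) (g x).
  by rewrite dotE tr_col -row_mul [RHS]mxE.
pose S := [set w | (tau * lam < eigval (Chat w) k.+1)%R].
have mS : measurable S by apply: measurable_eigval_gt.
have /andP[a0 a1] := ha; have /andP[t0 t1] := ht.
suff PF : fine (P (~` S)) <= alpha.
  have -> : P S = (1 - P (~` S))%E.
    by rewrite -[X in P X = _](setCK S) probability_setC//; exact: measurableC.
  rewrite -(@fineK _ (P (~` S))) ?fin_num_measure//; last exact: measurableC.
  by rewrite -EFinB lee_fin lerB.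
pose theta := (1 - tau) / (2 * L ^+ 2).
have LL : 0 < L ^+ 2 by rewrite exprn_gt0.
have tL : theta * L ^+ 2 = (1 - tau) / 2 by rewrite /theta; field; rewrite gt_eqF.
have k1 : 1 <= k.+1%:R :> R by rewrite ler1n.
have lam1 : 0 < lam <= eigval C 1.
  by rewrite lam0; apply: eigval_le.
apply: le_trans (exp_threshold k1 ha ht L0 lam1 hM); rewrite -/theta.
apply: (@probability_small_quad_exp _ _ _ _ _ P M X indX k.+1 v (L ^+ 2) lam
  (\row_(i < k.+1) eigval C i.+1)) => //.
- move=> a; have := bg (col a W).
  by congr bounded_mfun; apply/funext => x; rewrite vE.
(* Bessel's inequality: the squared norm of the residual [g x - W *m v x] is the difference of the
   two squared norms. *)
- move=> x; apply: le_trans (gg_le x).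
  rewrite -subr_ge0; apply: le_trans (dot_ge0 (g x - W *m v x)) _.
  rewrite dotBl !dotBr (dotC (W *m _) (g x)) !dot_mulmx [W^T *m (W *m _)]mulmxA WW mul1mx.
  by rewrite -/(v x) subrr subr0 lexx.
- move=> a; rewrite mxE; apply: eigval_le => //.
  by rewrite -ltnS ltn_ord.
(* The second moments are the entries of [W^T C W], diagonal since the columns of [W] are
   eigenvectors. *)
- move=> i a b; under eq_Rintegral do rewrite !vE.
  rewrite second_moment !colE [C *m _]mulmxA CW -mulmxA dot_mulmx mulmxA WW.
  by rewrite mul1mx dot_delta -colE mxE.
- by rewrite divr_ge0 ?subr_ge0 ?ltW// mulr_gt0.
- by rewrite mulr_ge0// ltW.
- by rewrite tL; lra.
- exact: measurableC.
move=> w /negP; rewrite -leNgt => hw.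
(* On the complement the frame [W] contains a unit vector on which the form of [Chat w] is at most
   [tau * lam]. *)
have [y yy hy] := eigval_frame_le (symChat w) kD WW.
exists y => //; apply: (@le_trans _ _ (M%:R * dot (W *m y) (Chat w *m (W *m y)))).
  rewrite dot_Chat mulrA divff ?mul1r ?pnatr_eq0 -?lt0n//.
  rewrite mulmx_suml dot_sumr; apply: ler_sum => i _.
  by rewrite mulmx_outer dotZr (dotC _ y) /v dot_mulmx trmxK.
by rewrite ler_wpM2l// (le_trans hy).
Qed.

(* The eigenvectors for the [de] leading eigenvalues lie in the range of [Chat w],
   which is contained in [T], and there are [\dim T] of them. *)
Lemma range_sample_covariance w t (T : {vspace 'cV[R]_D}) :
  \dim T = de -> determined_on f T -> (0 < de)%N ->
  0 < eigval (Chat w) de -> t \in T -> exists z, Chat w *m z = t.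
Proof.
move=> dT fT de0 ew tT.
have [W [WW AW]] := eigval_top_frame (symChat w) deD.
have colE j : Chat w *m col j W = eigval (Chat w) j.+1 *: col j W.
  rewrite [in LHS]colE mulmxA AW -colE; apply/colP => i.
  by rewrite mxE mul_mx_diag !mxE mulrC.
have ej (j : 'I_de) : 0 < eigval (Chat w) j.+1.
  have ew' : 0 < eigval (Chat w) de.-1.+1 by rewrite prednK.
  apply: (lt_le_trans ew'); apply: eigval_le => //.
  by rewrite -ltnS !prednK// ltn_ord.
pose s := [tuple col j W | j < de].
have sE (c : 'I_de -> R) : \sum_j c j *: s`_j = W *m \col_j c j.
  apply/colP => i; rewrite mxE summxE; apply: eq_bigr => j _.
  by rewrite -tnth_nth tnth_mktuple !mxE mulrC.
have sT : (span s <= T)%VS.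
  apply/span_subvP => _ /mapP[j _ ->].
  have -> : col j W = (eigval (Chat w) j.+1)^-1 *: (Chat w *m col j W).
    by rewrite colE scalerA mulVf ?scale1r// gt_eqF.
  apply: memvZ; rewrite /Chat /sample_covariance -scalemxAl mulmx_suml.
  apply: memvZ; apply: memv_suml => i _.
  rewrite mulmx_outer; apply: memvZ; exact: gradient_mem.
have fs : free s.
  apply/freeP => c; rewrite sE => Wc j.
  have /colP/(_ j) : \col_j c j = 0.
    by rewrite -[LHS]mul1mx -WW -mulmxA Wc mulmx0.
  by rewrite !mxE.
have sTE : span s = T.
  by apply/eqP; rewrite eqEdim sT dT (eqP fs) size_tuple leqnn.
move: tT; rewrite -sTE => /coord_span ->.
exists (\sum_j (coord s j t / eigval (Chat w) j.+1) *: s`_j).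
rewrite mulmx_sumr; apply: eq_bigr => j _.
rewrite -scalemxAr -tnth_nth tnth_mktuple colE scalerA divfK ?gt_eqF//.
Qed.

(** For a minimizer [x], the projection [t] of [x - p] on [T] is reached as [Chat w *m z]. Then
    [t + p] differs from [x] by a vector orthogonal to [T], which leaves [f] unchanged. *)
Lemma successful_of_eigval_gt0 w p : (0 < de)%N -> 0 < eigval (Chat w) de ->
  exists z, f (Chat w *m z + p) = fstar.
Proof.
move=> de0 ew; have [[T dT fT] _] := fde; have [[x fx] _] := fmin.
have [t tT xt] := orth_decomposition T (x - p).
have [z zt] := range_sample_covariance dT fT de0 ew tT.
exists z; rewrite zt -fx.
rewrite -(determined_on_translate fT (t + p) xt); congr f.
by rewrite addrC addrA !subrK.
Qed.

Lemma probability_success (alpha : R) (p : 'cV[R]_D) :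
  (0 < de)%N -> 0 < alpha <= 1 ->
  4 * eigval C 1 * L ^+ 2 / eigval C de ^+ 2 * ln (de%:R / alpha) <= M%:R ->
  ((1 - alpha)%:E <= P [set w | exists z, f (Chat w *m z + p) = fstar])%E.
Proof.
move=> de0 ha hM.
have dep : (de.-1 < de)%N by rewrite prednK.
(* The choice [tau = 0] turns the lower bound into positivity of the [de]-th sample eigenvalue,
   which implies success. *)
have := @eigval_sample_covariance_lower alpha 0 de.-1 ha.
rewrite prednK// subr0 expr1n mulr1 mul0r lexx ltr01 => /(_ erefl (leqnn _) hM).
move=> h; apply: (le_trans h); apply: le_measure; rewrite ?inE.
- have := measurable_eigval_gt 0 mChat symChat (leq_trans dep deD).
  by rewrite prednK.
- apply: measurable_exists_min mChat; last exact: fmin.2.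
  by move=> x; exact: differentiable_continuous.
- by move=> w /= ew; exact: successful_of_eigval_gt0.
Qed.

End active_subspace.

Theorem theorem3p6 (R : realType) (D : nat) (f : 'cV[R]_D -> R) (de : nat)
    (fstar L : R) (rho : borelRn R D -> R)
    (disp : measure_display) (Omega : measurableType disp)
    (P : probability Omega R) (M : nat) (X : 'I_M -> {RV P >-> borelRn R D})
    (C := grad_covariance f rho)
    (Chat := fun w : Omega => sample_covariance f (fun j => X j w)) :
  (1 <= D)%N ->
  continuously_differentiable f ->
  effective_dim f de ->
  (1 <= de)%N ->
  is_global_min f fstar ->
  0 < L ->
  (forall x, enorm (gradient f x) <= L) ->
  prob_density rho ->
  full_support rho ->
  (1 <= M)%N ->
  mutually_independent X ->
  (forall j, has_density (X j) rho) ->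
  (forall (alpha tau : R) (k : nat),
     0 < alpha <= 1 -> 0 <= tau < 1 -> (1 <= k <= de)%N ->
     4 * eigval C 1 * L ^+ 2 / (eigval C k ^+ 2 * (1 - tau) ^+ 2)
       * ln (k%:R / alpha) <= M%:R ->
     ((1 - alpha)%:E <=
        P [set w | (tau * eigval C k < eigval (Chat w) k)%R])%E)
  /\
  (forall (alpha : R) (p : 'cV[R]_D)
          (Uhat : forall w : Omega, 'M[R]_(D, \rank (Chat w))),
     0 < alpha <= 1 ->
     (forall w, is_range_basis (Chat w) (Uhat w)) ->
     4 * eigval C 1 * L ^+ 2 / eigval C de ^+ 2
       * ln (de%:R / alpha) <= M%:R ->
     ((1 - alpha)%:E <=
        P [set w | successful f fstar (Uhat w) p])%E).
Proof.
move=> _ fC1 fde de0 fmin L0 gL rho_pd rho_full M0 indX Xrho.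
have lower := eigval_sample_covariance_lower fC1 fde L0 gL rho_pd rho_full M0
  indX Xrho.
split=> [alpha tau [//|k] ha ht /andP[_ kde]|alpha p Uhat ha hU hM].
  exact: lower.
(* A range basis has the column space of [Chat w], so [Uhat] is eliminated and the event is
   expressed through a matrix with measurable entries. *)
have -> : [set w | successful f fstar (Uhat w) p] =
    [set w | exists z, f (Chat w *m z + p) = fstar].
  apply/seteqP; split => w [y yE] /=; rewrite /successful.
    have [z zE] := (range_basis_exists (hU w) _).1 (ex_intro _ y erefl).
    by exists z; rewrite zE.
  have [z zE] := (range_basis_exists (hU w) _).2 (ex_intro _ y erefl).
  by exists z; rewrite zE.
exact: (probability_success fC1 fde fmin L0 gL rho_pd rho_full M0 indX Xrho).
Qed.
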